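(* Let $(X,\phi)$ be a non-compact calibrated manifold and let $\Omega\subset\subset X$ be a relatively compact domain with smooth, strictly $\phi$-convex boundary $\partial\Omega$. Let $\delta=-\rho$, where $\rho$ is an arbitrary defining function for $\partial\Omega$. Then $-\log\delta:\Omega\to\mathbb R$ is strictly $\phi$-plurisubharmonic outside a compact subset of $\Omega$. Thus, in particular, the domain $\Omega$ is strictly $\phi$-convex at $\infty$.
   Context: A calibrated manifold $(X,\phi)$ of degree $p\ge 1$ is a smooth riemannian manifold $X$ together with a closed smooth $p$-form $\phi$ such that $\phi(\xi)\le 1$ for every unit simple tangent $p$-vector $\xi$ on $X$. $G_x(\phi)$ denotes the set of unit simple $p$-vectors $\xi$ at $x$ with $\phi(\xi)=1$ ($\phi$-planes), and $G(\phi)=\bigcup_xG_x(\phi)$; each $\xi$ determines a $p$-dimensional subspace $\mathrm{span}\,\xi\subset T_xX$. For a smooth function $f$ on an open subset of $X$, the $\phi$-Hessian of $f$ is the $p$-form $\mathcal H^\phi(f)(v_1,\dots,v_p)=\sum_{i=1}^p\phi(v_1,\dots,\nabla_{v_i}(\nabla f),\dots,v_p)$ ($\nabla_{v_i}(\nabla f)$ in the $i$-th slot, $\nabla$ the Levi-Civita connection). $f$ is $\phi$-plurisubharmonic if $\mathcal H^\phi(f)(\xi)\ge 0$ for all $\phi$-planes $\xi$ at points of its domain, and strictly $\phi$-plurisubharmonic at $x$ if $\mathcal H^\phi(f)(\xi)>0$ for all $\xi\in G_x(\phi)$. A defining function for $\partial\Omega$ is a smooth function $\rho$ on a neighborhood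 of $\overline\Omega$ with $\Omega=\{x:\rho(x)<0\}$ and $\nabla\rho\ne 0$ on $\partial\Omega$. The boundary $\partial\Omega$ is strictly $\phi$-convex if $\mathcal H^\phi(\rho)(\xi)>0$ for all $\xi\in G_x(\phi)$, $x\in\partial\Omega$, with $\mathrm{span}\,\xi\subset T_x(\partial\Omega)$; this condition does not depend on the choice of defining function $\rho$. $\Omega$ is strictly $\phi$-convex at $\infty$ if there is a smooth $\phi$-plurisubharmonic function $f:\Omega\to\mathbb R$ such that $\{x\in\Omega:f(x)\le c\}$ is compact for all $c\in\mathbb R$ and $f$ is strictly $\phi$-plurisubharmonic at all points outside some compact subset of $\Omega$. *)

(* Defs.v *)
From HB Require Import structures.
From mathcomp Require Import all_boot all_order all_algebra.
From mathcomp Require Import all_classical all_reals all_analysis.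

Set Implicit Arguments.
Unset Strict Implicit.
Unset Printing Implicit Defensive.

Import Order.TTheory GRing.Theory Num.Theory.
Import numFieldNormedType.Exports.

Local Open Scope classical_set_scope.
Local Open Scope ring_scope.

Definition boundary (X : topologicalType) (A : set X) : set X :=
  closure A `\` interior A.

Section EuclideanCalculus.
Context {R : realType} {n : nat}.
Implicit Types (D : set 'rV[R]_n) (f : 'rV[R]_n -> R).

Definition basis_vector (i : 'I_n) : 'rV[R]_n := delta_mx 0 i.

(* Only meant for open D: then the partial derivatives at the points of D
   depend on the restriction of f to D only. *)
Fixpoint C_on (k : nat) D f : Prop :=
  (forall y, D y -> {for y, continuous f}) /\
  match k with
  | 0 => True
  | k'.+1 => forall i : 'I_n,
      (forall y, D y -> derivable f y (basis_vector i)) /\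
      C_on k' D (fun y => 'D_(basis_vector i) f y)
  end.

Definition smooth_on D f : Prop := forall k, C_on k D f.

End EuclideanCalculus.

(* [chartV a] is the inverse of the chart [chart a : dom a -> R^n]; the values
   of [chart a] off [dom a], and of [chartV a] off the image of [dom a], are
   irrelevant. *)
Record manifold (R : realType) (n : nat) (X : topologicalType) := Manifold {
  chart_index : Type;
  dom : chart_index -> set X;
  chart : chart_index -> X -> 'rV[R]_n;
  chartV : chart_index -> 'rV[R]_n -> X;
  manifold_hausdorff : hausdorff_space X;
  manifold_second_countable : @second_countable X;
  dom_open : forall a, open (dom a);
  dom_cover : forall x, exists a, dom a x;
  chart_open : forall a, open (chart a @` dom a);
  chartK : forall a x, dom a x -> chartV a (chart a x) = x;
  chart_continuous : forall a x, dom a x -> {for x, continuous (chart a)};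
  chartV_continuous : forall a y, (chart a @` dom a) y ->
    {for y, continuous (chartV a)};
  transition_smooth : forall a b (j : 'I_n),
    smooth_on (chart a @` (dom a `&` dom b))
              (fun y => chart b (chartV a y) 0 j)
}.

(* A tangent vector at x is given by its components, a row vector, in each
   chart a around x; the components v in a and w in b describe the same vector
   when w = v *m transition_jacobian a b (chart a x). Tensor fields are given
   by their components in each chart, as functions of the coordinates
   y = chart a x. *)
Section Manifold.
Context {R : realType} {n : nat} {X : topologicalType} (M : manifold R n X).
Implicit Types (a b : chart_index M) (W : set X) (f : X -> R).

Definition chart_range a : set 'rV[R]_n := chart a @` dom a.

Definition transition_jacobian a b (y : 'rV[R]_n) : 'M[R]_n :=
  jacobian (chart b \o chartV a) y.

Definition smooth_fun W f : Prop :=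
  forall a, smooth_on (chart a @` (dom a `&` W)) (f \o chartV a).

Record riemannian_metric := RiemannianMetric {
  metric_mx : chart_index M -> 'rV[R]_n -> 'M[R]_n;
  metric_sym : forall a y, chart_range a y -> (metric_mx a y)^T = metric_mx a y;
  metric_pos : forall a y (v : 'rV[R]_n), chart_range a y -> v != 0 ->
    0 < (v *m metric_mx a y *m v^T) 0 0;
  metric_smooth : forall a (i j : 'I_n),
    smooth_on (chart_range a) (fun y => metric_mx a y i j);
  metric_change : forall a b x, dom a x -> dom b x ->
    let J := transition_jacobian a b (chart a x) in
    metric_mx a (chart a x) = J *m metric_mx b (chart b x) *m J^T
}.

Definition set_row (p : nat) (i : 'I_p) (w : 'rV[R]_n) (v : 'M[R]_(p, n))
    : 'M[R]_(p, n) :=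
  \matrix_(k, j) if k == i then w 0 j else v k j.

(* The arguments v_1, ..., v_p of a p-form are the rows of a p x n matrix. *)
Record smooth_form (p : nat) := SmoothForm {
  form_val :> chart_index M -> 'rV[R]_n -> 'M[R]_(p, n) -> R;
  form_linear : forall a y (v : 'M[R]_(p, n)) i (c : R) (u w : 'rV[R]_n),
    chart_range a y ->
    form_val a y (set_row i (c *: u + w) v) =
      c * form_val a y (set_row i u v) + form_val a y (set_row i w v);
  form_alternating : forall a y (v : 'M[R]_(p, n)) (i j : 'I_p),
    chart_range a y -> i != j -> row i v = row j v -> form_val a y v = 0;
  form_smooth : forall a (v : 'M[R]_(p, n)),
    smooth_on (chart_range a) (fun y => form_val a y v);
  form_change : forall a b x (v : 'M[R]_(p, n)), dom a x -> dom b x ->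
    form_val a (chart a x) v =
      form_val b (chart b x) (v *m transition_jacobian a b (chart a x))
}.

(* d phi (v_0, ..., v_p) = sum_i (-1)^i D_{v_i} (phi (.. omit v_i ..)) for
   constant v_0, ..., v_p in a chart. *)
Definition closed_form (p : nat) (phi : smooth_form p) : Prop :=
  forall a y (v : 'M[R]_(p.+1, n)), chart_range a y ->
    \sum_(i < p.+1)
      (-1) ^+ i * 'D_(row i v) (fun z => phi a z (row' i v)) y = 0.

Section Riemannian.
Variable g : riemannian_metric.

Definition inner a (y v w : 'rV[R]_n) : R := (v *m metric_mx g a y *m w^T) 0 0.

(* The rows of v represent the simple p-vector v_1 /\ ... /\ v_p, whose squared
   length is the Gram determinant of v_1, ..., v_p. *)
Definition unit_simple (p : nat) a (y : 'rV[R]_n) (v : 'M[R]_(p, n)) : Prop :=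
  \det (v *m metric_mx g a y *m v^T) = 1.

Definition calibration (p : nat) (phi : smooth_form p) : Prop :=
  closed_form phi /\
  forall a x (v : 'M[R]_(p, n)), dom a x ->
    unit_simple a (chart a x) v -> phi a (chart a x) v <= 1.

Definition phi_plane (p : nat) (phi : smooth_form p) a (y : 'rV[R]_n)
    (v : 'M[R]_(p, n)) : Prop :=
  unit_simple a y v /\ phi a y v = 1.

Definition gradient f a (y : 'rV[R]_n) : 'rV[R]_n :=
  (\row_i 'D_(basis_vector i) (f \o chartV a) y) *m invmx (metric_mx g a y).

(* Levi-Civita derivative of the constant field w along v in the chart a,
   by the Koszul formula
   2 <nabla_v w, e_l> = D_v <w, e_l> + D_w <v, e_l> - D_{e_l} <v, w>. *)
Definition christoffel a (y v w : 'rV[R]_n) : 'rV[R]_n :=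
  (\row_l (2^-1 *
     ('D_v (fun z => inner a z w (basis_vector l)) y
      + 'D_w (fun z => inner a z v (basis_vector l)) y
      - 'D_(basis_vector l) (fun z => inner a z v w) y)))
  *m invmx (metric_mx g a y).

Definition levi_civita a (y v : 'rV[R]_n) (Z : 'rV[R]_n -> 'rV[R]_n)
    : 'rV[R]_n :=
  'D_v Z y + christoffel a y v (Z y).

Section Plurisubharmonic.
Context {p : nat} (phi : smooth_form p).

Definition phi_hessian f a (y : 'rV[R]_n) (v : 'M[R]_(p, n)) : R :=
  \sum_(i < p) phi a y (set_row i (levi_civita a y (row i v) (gradient f a)) v).

Definition strictly_psh_at f (x : X) : Prop :=
  forall a (v : 'M[R]_(p, n)), dom a x ->
    phi_plane phi a (chart a x) v -> 0 < phi_hessian f a (chart a x) v.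

(* The set W of the following two definitions is meant to be open. *)
Definition psh_on W f : Prop :=
  smooth_fun W f /\
  forall a x (v : 'M[R]_(p, n)), W x -> dom a x ->
    phi_plane phi a (chart a x) v -> 0 <= phi_hessian f a (chart a x) v.

Definition strictly_psh_on W f : Prop :=
  smooth_fun W f /\ forall x, W x -> strictly_psh_at f x.

Definition strictly_psh_outside_compact (Omega : set X) f : Prop :=
  exists K : set X,
    [/\ compact K, K `<=` Omega & strictly_psh_on (Omega `\` K) f].

Definition defining_function (Omega U : set X) (rho : X -> R) : Prop :=
  [/\ open U, closure Omega `<=` U, smooth_fun U rho,
      Omega = U `&` [set x | rho x < 0] &
      forall a x, boundary Omega x -> dom a x ->
        gradient rho a (chart a x) != 0].

(* T_x(boundary Omega) is the kernel of the differential of a defining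
   function. *)
Definition strictly_convex_boundary (Omega : set X) : Prop :=
  exists (U : set X) (rho : X -> R), defining_function Omega U rho /\
    forall a x (v : 'M[R]_(p, n)), boundary Omega x -> dom a x ->
      phi_plane phi a (chart a x) v ->
      (forall i, 'D_(row i v) (rho \o chartV a) (chart a x) = 0) ->
      0 < phi_hessian rho a (chart a x) v.

Definition strictly_convex_at_infinity (Omega : set X) : Prop :=
  exists f : X -> R,
    [/\ psh_on Omega f,
        forall c : R, compact (Omega `&` [set x | f x <= c]) &
        strictly_psh_outside_compact Omega f].

End Plurisubharmonic.
End Riemannian.
End Manifold.

(* Main.v *)
Require Import Defs.
From HB Require Import structures.
From mathcomp Require Import all_boot all_order all_algebra.
From mathcomp Require Import all_classical all_reals all_analysis.
From mathcomp Require Import ring lra.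

(** Why the theorem holds.

    Write u = - log (- rho).  If h is a function of one variable, then on a
    phi-plane spanned by v_1, ..., v_p the phi-Hessian of h o f is
      h'(f) H(f) + h''(f) sum_i (v_i f) phi(v_1, .., grad f, .., v_p)
    ([phi_hessian_post]).  A calibration attains its maximum 1 exactly on its
    phi-planes, so its first variation there vanishes: if e is an orthonormal
    frame of a phi-plane, replacing e_i by w in phi(e_1, .., e_p) gives
    <w, e_i> ([first_cousin], [comass_form_coord]).  Hence H(f) is the trace of
    the Riemannian Hessian of f over the plane, and the second sum is the squared
    length of the projection of grad f to the plane ([phi_plane_frame]).  For
    h(t) = - log (- t) and delta = - rho this reads
      delta^2 H(u) = delta H(rho) + |projection of grad rho|^2.
    At a boundary point delta vanishes.  If the plane is not tangent to the
    boundary, the square is positive there, hence on nearby planes; if it is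
    tangent, H(rho) is positive by strict convexity, hence on nearby planes too,
    and the square never hurts.  Orthonormal frames form a compact set, so the
    right-hand side is positive on all phi-planes at points of Omega close to the
    boundary ([boundary_estimate], [neglog_strictly_psh_near]).  What is left of
    Omega is contained in a compact subset.

    Two points need care.  Strict convexity is given for some defining function
    rho0, while rho is arbitrary.  At a boundary point d rho0 = lam d rho with
    lam > 0, and the Hessians compare on tangent vectors: if a parabola
    y + t v + t^2 w enters the domain to second order for rho, it cannot leave
    it to second order for rho0 ([boundary_covector], [boundary_second_order]).
    Moreover plurisubharmonicity is a condition in every chart, and the estimate
    is obtained in one chart around each boundary point; so the phi-Hessian has
    to be independent of the chart, which rests on the symmetry of the second
    derivatives of the transition maps ([hess_pull], [strictly_psh_chart]).

    For convexity at infinity let c bound u on the compact set off which u is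
    strictly plurisubharmonic, and let chi(t) = t exp(-1/t) for t > 0 and
    chi(t) = 0 for t <= 0, a smooth convex unbounded function, increasing on the
    positive half-line.  Then f = chi(u - c) is plurisubharmonic on all of Omega:
    it is flat where u <= c, and H(f) >= chi'(u - c) H(u) > 0 where u > c.  Its
    sublevel sets stay away from the boundary because chi is unbounded
    ([cutoff_post_psh], [strictly_convex_at_infinity_of_neglog]). *)

Set Implicit Arguments.
Unset Strict Implicit.
Unset Printing Implicit Defensive.

Import Order.TTheory GRing.Theory Num.Theory.
Import numFieldNormedType.Exports.

Local Open Scope classical_set_scope.
Local Open Scope ring_scope.

(** * Calculus in R^n *)

Section LineCalculus.
Context {R : realType}.

Lemma mean_value (g g' : R -> R) (t : R) :
  (forall s : R, `|s| <= `|t| -> is_derive s 1 g (g' s)) ->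
  exists2 th, `|th| <= `|t| & g t - g 0 = t * g' th.
Proof.
move=> dg.
have gc s : `|s| <= `|t| -> {for s, continuous g}.
  by move=> /dg [dgs _]; apply/differentiable_continuous/derivable1_diffP.
have gcw (a b : R) : (forall s, s \in `[a, b] -> `|s| <= `|t|) ->
    {within `[a, b], continuous g}.
  move=> ab; apply: continuous_in_subspaceT => s /set_mem /= sab.
  exact/gc/ab.
have [t0|t0|->] := ltgtP t 0.
- have tE s : s \in `[t, 0] -> `|s| <= `|t|.
    by rewrite in_itv/= => /andP[ts s0]; rewrite !ler0_norm ?lerN2// ltW.
  have [c|c ct gE] := MVT (df := g') t0 _ (gcw _ _ tE).
    by move=> ct; apply/dg/tE; move: ct; rewrite !in_itv/= => /andP[/ltW-> /ltW->].
  exists c; first by apply: tE; move: ct; rewrite !in_itv/= => /andP[/ltW-> /ltW->].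
  by move: gE; rewrite sub0r => gE; lra.
- have tE s : s \in `[0, t] -> `|s| <= `|t|.
    by rewrite in_itv/= => /andP[ts s0]; rewrite !ger0_norm// ltW.
  have [c|c ct gE] := MVT (df := g') t0 _ (gcw _ _ tE).
    by move=> ct; apply/dg/tE; move: ct; rewrite !in_itv/= => /andP[/ltW-> /ltW->].
  exists c; first by apply: tE; move: ct; rewrite !in_itv/= => /andP[/ltW-> /ltW->].
  by move: gE; rewrite subr0 => gE; lra.
- by exists 0; rewrite ?subrr ?mul0r.
Qed.

Lemma is_derive_line {V W : normedModType R} (f : V -> W) (z v : V) (s : R) :
  derivable f (z + s *: v) v ->
  is_derive s 1 (fun s => f (z + s *: v)) ('D_v f (z + s *: v)).
Proof.
have E : (fun h => h^-1 *: ((f \o shift (z + s *: v)) (h *: v) - f (z + s *: v)))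
   = (fun h => h^-1 *: (((fun s => f (z + s *: v)) \o shift s) (h *: (1 : R)) - f
     (z + s *: v))).
  apply/funext => h /=; congr (_ *: (f _ - _)).
  by rewrite [h *: 1]mulr1 scalerDl addrCA.
by rewrite /derivable E => df; split => //; rewrite /derive -E.
Qed.

Lemma mean_value_line {V : normedModType R} (f : V -> R) (z v : V) (t : R) :
  (forall s, `|s| <= `|t| -> derivable f (z + s *: v) v) ->
  exists2 th, `|th| <= `|t| &
    f (z + t *: v) - f z = t * 'D_v f (z + th *: v).
Proof.
move=> df; have [|th tht E] := @mean_value (fun s => f (z + s *: v))
  (fun s => 'D_v f (z + s *: v)) t.
  by move=> s st; apply/is_derive_line/df.
by exists th => //; rewrite -E scale0r addr0.
Qed.

End LineCalculus.

Lemma cvg_sumR {R : realType} {T : Type} {F : set_system T} {FF : Filter F}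
    (I : Type) (r : seq I) (P : pred I) (f : I -> T -> R) (a : I -> R) :
  (forall i, P i -> f i x @[x --> F] --> a i) ->
  \sum_(i <- r | P i) f i x @[x --> F] --> \sum_(i <- r | P i) a i.
Proof. by move=> fa; apply: cvg_big => //; exact: add_continuous. Qed.

Lemma continuous_sumR {R : realType} {T : topologicalType} (x : T)
    (I : Type) (r : seq I) (P : pred I) (f : I -> T -> R) :
  (forall i, P i -> {for x, continuous (f i)}) ->
  {for x, continuous (fun y => \sum_(i <- r | P i) f i y)}.
Proof. by move=> fa; apply: (@cvg_sumR R T (nbhs x)). Qed.

Section Calculus.
Context {R : realType} {n : nat}.
Implicit Types (D : set 'rV[R]_n) (f g : 'rV[R]_n -> R) (y v w : 'rV[R]_n).

Definition first_coords (k : nat) (h : 'rV[R]_n) : 'rV[R]_n :=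
  \row_j if (j < k)%N then h 0 j else 0.

Lemma coord_le_norm m (h : 'M[R]_(m, n)) i j : `|h i j| <= `|h|.
Proof.
rewrite [leRHS]/Num.Def.normr/= mx_normrE.
exact: (le_bigmax _ (fun ij => `|h ij.1 ij.2|) (i, j)).
Qed.

Lemma norm_le_coord (m : nat) (h : 'M[R]_(m, n)) c : 0 <= c ->
  (forall i j, `|h i j| <= c) -> `|h| <= c.
Proof.
move=> c0 hc; rewrite /Num.Def.normr/= mx_normrE.
by apply: bigmax_le => // -[i j] _; exact: hc.
Qed.

(** The increment is split into steps along the coordinate axes, and the mean
    value theorem is applied to each step; so the oscillation of the partial
    derivatives controls the error of the linear approximation. *)
Lemma partial_bound f y (d e : R) (h : 'rV[R]_n) :
  (forall z, `|z - y| < d -> forall i, derivable f z (basis_vector i) /\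
     `|'D_(basis_vector i) f z - 'D_(basis_vector i) f y| <= e) ->
  `|h| < d ->
  `|f (y + h) - f y - \sum_i h 0 i * 'D_(basis_vector i) f y| <= n%:R * (e * `|h|).
Proof.
move=> H hd.
suff P k : (k <= n)%N -> `|f (y + first_coords k h) - f y -
    \sum_(i < n | (i < k)%N) h 0 i * 'D_(basis_vector i) f y| <= k%:R * (e * `|h|).
  have := P n (leqnn _).
  have -> : first_coords n h = h by apply/rowP => j; rewrite mxE ltn_ord.
  by under eq_bigl do rewrite ltn_ord.
elim: k => [_|k IH kn].
  rewrite big_pred0// subr0 mul0r.
  have -> : first_coords 0 h = 0 by apply/rowP => j; rewrite !mxE.
  by rewrite addr0 subrr normr0.
have := IH (ltnW kn); pose i0 := Ordinal kn => {}IH.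
have tS : first_coords k.+1 h = first_coords k h + h 0 i0 *: basis_vector i0.
  apply/rowP => j; rewrite !mxE eqxx/= ltnS leq_eqVlt.
  rewrite -[j == i0]/(nat_of_ord j == k).
  case: eqVneq => [jk|jk]/=; last by rewrite mulr0 addr0.
  by rewrite jk ltnn add0r mulr1; congr (h 0 _); apply/val_inj.
have inb s : `|s| <= `|h 0 i0| -> `|y + first_coords k h + s *: basis_vector i0 - y| < d.
  move=> sh; apply: le_lt_trans hd.
  rewrite addrAC [y + _]addrC addrK; apply: norm_le_coord => // i j.
  rewrite ord1 !mxE eqxx/= -[j == i0]/(nat_of_ord j == k).
  have [->|jk] := eqVneq (nat_of_ord j) k.
    by rewrite ltnn add0r mulr1 (le_trans sh)// coord_le_norm.
  rewrite mulr0 addr0; case: ifP => _; last by rewrite normr0.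
  exact: coord_le_norm.
have [s /inb/H/(_ i0)[]//|th thh E] :=
  @mean_value_line R _ f (y + first_coords k h) (basis_vector i0) (h 0 i0).
rewrite (bigD1 i0)//=.
rewrite (eq_bigl (fun i : 'I_n => (i < k)%N)); last first.
  move=> i; rewrite ltnS ltn_neqAle -[i == i0]/(nat_of_ord i == k).
  by rewrite andbC.
rewrite tS addrA.
have [_ He] := H _ (inb _ thh) i0.
rewrite -natr1 mulrDl mul1r.
set a := f (y + first_coords k h) in IH E *; set b := f (y + _ + _) in E *.
set S := \sum_(_ < n | _) _ in IH *.
have -> : b - f y - (h 0 i0 * 'D_(basis_vector i0) f y + S) =
  (a - f y - S) + h 0 i0 * ('D_(basis_vector i0) f
    (y + first_coords k h + th *: basis_vector i0)
     - 'D_(basis_vector i0) f y).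
  rewrite mulrBr -E; ring.
apply: (le_trans (ler_normD _ _)); apply: lerD => //.
by rewrite normrM mulrC ler_pM// coord_le_norm.
Qed.

Lemma open_near D y : open D -> D y -> \forall z \near y, D z.
Proof. by move=> oD Dy; apply: open_nbhs_nbhs; split. Qed.

(** Smoothness is phrased with partial derivatives only; this gives the
    Frechet derivative, hence the derivatives along arbitrary vectors. *)
Lemma C1_differentiable f y :
  (\forall z \near y, forall i, derivable f z (basis_vector i)) ->
  (forall i, {for y, continuous ('D_(basis_vector i) f)}) ->
  differentiable f y /\ forall v, 'D_v f y = \sum_i v 0 i * 'D_(basis_vector i) f y.
Proof.
move=> dn cn.
pose L := fun v : 'rV[R]_n => \sum_i v 0 i * 'D_(basis_vector i) f y.
have Llin : linear L.
  move=> c u v; rewrite /L scaler_sumr -big_split/=; apply: eq_bigr => i _.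
  by rewrite !mxE mulrDl [_ *: _]mulrA.
pose LL := GRing.isLinear.Build _ _ _ _ L Llin.
pose Lh : {linear 'rV[R]_n -> R^o} := HB.pack L LL.
(* The candidate differential L has to be continuous to qualify. *)
have Lc : continuous Lh.
  move=> v; apply: continuous_sumR => i _.
  exact: (cvgM (@coord_continuous R _ _ 0 i v) (cvg_cst _)).
have dl : f \o shift y = cst (f y) + (Lh : 'rV[R]_n -> R^o) +o_ (0 : 'rV[R]_n) id.
  apply/eqaddoP => _/posnumP[e].
  have n0 : 0 < e%:num / n.+1%:R by rewrite divr_gt0.
  have cn' : \forall z \near y, forall i : 'I_n,
     `|'D_(basis_vector i) f z - 'D_(basis_vector i) f y| <= e%:num / n.+1%:R.
    have cne i : \forall z \near y,
       `|'D_(basis_vector i) f z - 'D_(basis_vector i) f y| <= e%:num / n.+1%:R.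
      have /cvgrPdist_le/(_ _ n0) := cn i.
      by apply: filterS => z; rewrite distrC.
    exact: filter_forall cne.
  have [d /= d0 dP] := (nbhs_ballP _ _).1 (filterI dn cn').
  near=> h.
  rewrite [X in `|X|](_ : _ = f (y + h) - f y - L h); last first.
    by transitivity (f (h + y) - (f y + L h)) => //; rewrite [h + y]addrC opprD addrA.
  apply: le_trans (@partial_bound f y d (e%:num / n.+1%:R) h _ _) _.
  - move=> z zy; have [|A B] := dP z; first by rewrite -ball_normE/= distrC.
    by move=> i; split; [exact: A|exact: B].
  - by near: h; apply/nbhs_ballP; exists d => //= z; rewrite -ball_normE/= sub0r normrN.
  - rewrite mulrA ler_wpM2r//.
    rewrite mulrC -mulrA ler_piMr// mulrC ler_pdivrMr// mul1r.
    by rewrite ler_nat.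
have df : 'd f y = Lh :> ('rV[R]_n -> R^o).
  exact: (@diff_unique R _ R^o f Lh y Lc dl).
have dff : differentiable f y.
  by apply/diff_locallyP; rewrite df; split.
split => // v.
by rewrite (@deriveE R _ R^o)// df.
Unshelve. all: by end_near. Qed.

End Calculus.

Section Smooth.
Context {R : realType} {n : nat}.
Implicit Types (D : set 'rV[R]_n) (f g : 'rV[R]_n -> R) (y v w : 'rV[R]_n).

Lemma derivable_addE f g y v : derivable f y v -> derivable g y v ->
  derivable (fun z => f z + g z) y v /\
  'D_v (fun z => f z + g z) y = 'D_v f y + 'D_v g y.
Proof.
by move=> df dg; split; [exact: (derivableD df dg)|exact: (deriveD df dg)].
Qed.

Lemma derivable_mulE f g y v : derivable f y v -> derivable g y v ->
  derivable (fun z => f z * g z) y v /\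
  'D_v (fun z => f z * g z) y = f y * 'D_v g y + g y * 'D_v f y.
Proof.
by move=> df dg; split; [exact: (derivableM df dg)|exact: (deriveM df dg)].
Qed.

Lemma derivable_cstE (c : R) y v :
  derivable (fun=> c : R) y v /\ 'D_v (fun=> c : R) y = 0.
Proof. by split; [exact: derivable_cst|exact: derive_cst]. Qed.

Lemma derivable_sumE (I : Type) (r : seq I) (P : pred I)
    (f : I -> 'rV[R]_n -> R) y v :
  (forall i, P i -> derivable (f i) y v) ->
  derivable (fun z => \sum_(i <- r | P i) f i z) y v /\
  'D_v (fun z => \sum_(i <- r | P i) f i z) y = \sum_(i <- r | P i) 'D_v (f i) y.
Proof.
move=> df; elim: r => [|i r [IH1 IH2]].
  rewrite big_nil (_ : (fun z => _) = fun=> 0); first exact: derivable_cstE.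
  by apply/funext => z; rewrite big_nil.
rewrite big_cons; case: ifPn => Pi; last first.
  rewrite (_ : (fun z => _) = fun z => \sum_(i <- r | P i) f i z)//.
  by apply/funext => z; rewrite big_cons (negbTE Pi).
rewrite (_ : (fun z => _) = fun z => f i z + \sum_(i <- r | P i) f i z).
  by rewrite -IH2; apply: derivable_addE => //; exact: df.
by apply/funext => z; rewrite big_cons Pi.
Qed.

Lemma derivable_ext f g y v : (\forall z \near y, f z = g z) ->
  derivable f y v -> derivable g y v.
Proof. by move=> fg; exact: near_eq_derivable. Qed.

Lemma continuous_ext (T : topologicalType) (f g : T -> R) (y : T) :
  (\forall z \near y, f z = g z) ->
  {for y, continuous f} -> {for y, continuous g}.
Proof.
move=> fg cf; have : f z @[z --> y] --> g y by rewrite -(nbhs_singleton fg).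
by apply: cvg_trans; apply: near_eq_cvg; apply: filterS fg.
Qed.

Lemma smooth_continuous D f y : smooth_on D f -> D y -> {for y, continuous f}.
Proof. by move=> /(_ 0) [+ _]; exact. Qed.

Lemma smooth_derivable_basis D f y i :
  smooth_on D f -> D y -> derivable f y (basis_vector i).
Proof. by move=> /(_ 1) [_ /(_ i)[+ _]]; exact. Qed.

Lemma smooth_partial D f (i : 'I_n) : smooth_on D f -> smooth_on D ('D_(basis_vector i) f).
Proof. by move=> sf k; have [_ /(_ i)[]] := sf k.+1. Qed.

Lemma C_on_sub D D' k f : D' `<=` D -> C_on k D f -> C_on k D' f.
Proof.
move=> DD; elim: k f => [|k IH] f [cf df]; split => //; try by move=> y /DD/cf.
by move=> i; have [df1 df2] := df i; split; [move=> y /DD/df1|exact: IH].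
Qed.

Lemma smooth_on_sub D D' f : D' `<=` D -> smooth_on D f -> smooth_on D' f.
Proof. by move=> DD sf k; exact: C_on_sub (sf k). Qed.

Lemma near_open_eq D f g y : open D -> (forall z, D z -> f z = g z) -> D y ->
  \forall z \near y, f z = g z.
Proof. by move=> oD fg Dy; apply: filterS (open_near oD Dy); exact: fg. Qed.

Lemma C_on_ext D k f g : open D -> (forall z, D z -> f z = g z) ->
  C_on k D f -> C_on k D g.
Proof.
move=> oD; elim: k f g => [|k IH] f g fg [cf df]; split => //.
- by move=> y Dy; apply: continuous_ext (near_open_eq oD fg Dy) (cf y Dy).
- by move=> y Dy; apply: continuous_ext (near_open_eq oD fg Dy) (cf y Dy).
- move=> i; have [df1 df2] := df i; split.
    by move=> y Dy; apply: derivable_ext (near_open_eq oD fg Dy) (df1 y Dy).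
  by apply: IH df2 => z Dz; apply: near_eq_derive (near_open_eq oD fg Dz).
Qed.

Lemma smooth_on_ext D f g : open D -> (forall z, D z -> f z = g z) ->
  smooth_on D f -> smooth_on D g.
Proof. by move=> oD fg sf k; exact: C_on_ext (sf k). Qed.

(** By the Leibniz rule this algebra is stable under partial derivatives as
    soon as it contains those of its generators. *)
Inductive generated (G : set ('rV[R]_n -> R)) : set ('rV[R]_n -> R) :=
| generated_gen f of G f : generated G f
| generated_cst c : generated G (fun=> c)
| generated_add f g of generated G f & generated G g :
    generated G (fun z => f z + g z)
| generated_mul f g of generated G f & generated G g :
    generated G (fun z => f z * g z).

(** By induction on the order of differentiation: as soon as the first partial
    derivatives of the generators fall back into the algebra, all the higher ones
    do.  Proving smoothness then takes a single differentiation. *)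
Lemma smooth_coind D (G : set ('rV[R]_n -> R)) : open D ->
  (forall f y, G f -> D y -> {for y, continuous f}) ->
  (forall f i, G f -> (forall y, D y -> derivable f y (basis_vector i)) /\
     exists2 h, generated G h & forall y, D y -> 'D_(basis_vector i) f y = h y) ->
  forall f, generated G f -> smooth_on D f.
Proof.
move=> oD Gc Gd.
have gc f : generated G f -> forall y, D y -> {for y, continuous f}.
  elim=> {f} [f Gf|c|f g _ IHf _ IHg|f g _ IHf _ IHg] y Dy.
  - exact: (Gc _ _ Gf Dy).
  - exact: (@cst_continuous _ _ c y).
  - exact: (continuousD (IHf y Dy) (IHg y Dy)).
  - exact: (continuousM (IHf y Dy) (IHg y Dy)).
have gd f : generated G f -> forall i,
    (forall y, D y -> derivable f y (basis_vector i)) /\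
    exists2 h, generated G h & forall y, D y -> 'D_(basis_vector i) f y = h y.
  elim=> {f} [f Gf|c|f g Gf IHf Gg IHg|f g Gf IHf Gg IHg] i.
  - exact: Gd.
  - split; first by move=> y _; exact: (derivable_cstE _ _ _).1.
    exists (fun=> 0); first exact: generated_cst.
    by move=> y _; exact: (derivable_cstE _ _ _).2.
  - have [df [h Gh fh]] := IHf i; have [dg [k Gk gk]] := IHg i; split.
      by move=> y Dy; exact: (derivable_addE (df y Dy) (dg y Dy)).1.
    exists (fun z => h z + k z); first exact: generated_add.
    move=> y Dy; rewrite -fh// -gk//.
    exact: (derivable_addE (df y Dy) (dg y Dy)).2.
  - have [df [h Gh fh]] := IHf i; have [dg [k Gk gk]] := IHg i; split.
      by move=> y Dy; exact: (derivable_mulE (df y Dy) (dg y Dy)).1.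
    exists (fun z => f z * k z + g z * h z).
      by apply: generated_add; apply: generated_mul.
    move=> y Dy; rewrite -fh// -gk//.
    exact: (derivable_mulE (df y Dy) (dg y Dy)).2.
move=> f Gf k; elim: k f Gf => [|k IH] f Gf; split => //; try exact: gc.
move=> i; have [df [h Gh fh]] := gd f Gf i; split=> //.
by apply: C_on_ext (IH h Gh) => // z Dz; rewrite fh.
Qed.

Lemma smooth_generated D f : open D -> generated (smooth_on D) f -> smooth_on D f.
Proof.
move=> oD; apply: smooth_coind => //.
  by move=> {}f y sf Dy; exact: smooth_continuous sf Dy.
move=> {}f i sf; split; first by move=> y Dy; exact: smooth_derivable_basis sf Dy.
exists ('D_(basis_vector i) f) => //.
by apply: generated_gen; exact: smooth_partial.
Qed.

Lemma smooth_cst D (c : R) : open D -> smooth_on D (fun=> c).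
Proof. by move=> oD; apply: smooth_generated => //; exact: generated_cst. Qed.

Lemma smooth_add D f g : open D -> smooth_on D f -> smooth_on D g ->
  smooth_on D (fun z => f z + g z).
Proof.
by move=> oD sf sg; apply: smooth_generated => //; apply: generated_add;
  apply: generated_gen.
Qed.

Lemma smooth_mul D f g : open D -> smooth_on D f -> smooth_on D g ->
  smooth_on D (fun z => f z * g z).
Proof.
by move=> oD sf sg; apply: smooth_generated => //; apply: generated_mul;
  apply: generated_gen.
Qed.

Lemma smooth_opp D f : open D -> smooth_on D f -> smooth_on D (fun z => - f z).
Proof.
move=> oD sf; rewrite (_ : (fun z => _) = fun z => (-1) * f z).
  by apply: smooth_mul => //; exact: smooth_cst.
by apply/funext => z; rewrite mulN1r.
Qed.

Lemma smooth_sum D (I : Type) (r : seq I) (P : pred I) (f : I -> 'rV[R]_n -> R) :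
  open D -> (forall i, P i -> smooth_on D (f i)) ->
  smooth_on D (fun z => \sum_(i <- r | P i) f i z).
Proof.
move=> oD sf; elim: r => [|i r IH].
  rewrite (_ : (fun z => _) = fun=> 0); first exact: smooth_cst.
  by apply/funext => z; rewrite big_nil.
rewrite (_ : (fun z => _) = fun z => (if P i then f i z else 0) + \sum_(i <- r | P i) f i z).
  by apply: smooth_add => //; case: (boolP (P i)) => Pi; [exact: sf|exact: smooth_cst].
by apply/funext => z; rewrite big_cons; case: ifP; rewrite ?add0r.
Qed.

Lemma smooth_prod D (I : Type) (r : seq I) (P : pred I) (f : I -> 'rV[R]_n -> R) :
  open D -> (forall i, P i -> smooth_on D (f i)) ->
  smooth_on D (fun z => \prod_(i <- r | P i) f i z).
Proof.
move=> oD sf; elim: r => [|i r IH].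
  rewrite (_ : (fun z => _) = fun=> 1); first exact: smooth_cst.
  by apply/funext => z; rewrite big_nil.
rewrite (_ : (fun z => _) = fun z => (if P i then f i z else 1) * \prod_(i <- r | P i) f i z).
  by apply: smooth_mul => //; case: (boolP (P i)) => Pi; [exact: sf|exact: smooth_cst].
by apply/funext => z; rewrite big_cons; case: ifP; rewrite ?mul1r.
Qed.

Lemma smooth_det D m (A : 'rV[R]_n -> 'M[R]_m) : open D ->
  (forall i j, smooth_on D (fun z => A z i j)) -> smooth_on D (fun z => \det (A z)).
Proof.
move=> oD sA; apply: smooth_sum => // s _; apply: smooth_mul => //.
  exact: smooth_cst.
by apply: smooth_prod => // i _; exact: sA.
Qed.

Lemma smooth_diff D f y : open D -> smooth_on D f -> D y ->
  differentiable f y /\ forall v, 'D_v f y = \sum_i v 0 i * 'D_(basis_vector i) f y.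
Proof.
move=> oD sf Dy; apply: C1_differentiable.
  apply: filterS (open_near oD Dy) => z Dz i.
  exact: smooth_derivable_basis sf Dz.
by move=> i; exact: smooth_continuous (smooth_partial i sf) Dy.
Qed.

Lemma smooth_derivable D f y v : open D -> smooth_on D f -> D y -> derivable f y v.
Proof. by move=> oD sf Dy; apply/diff_derivable/(smooth_diff oD sf Dy).1. Qed.

Lemma smooth_derive D f v : open D -> smooth_on D f -> smooth_on D ('D_v f).
Proof.
move=> oD sf.
apply: (smooth_on_ext (f := fun z => \sum_i v 0 i * 'D_(basis_vector i) f z)) => //.
  by move=> z Dz; rewrite (smooth_diff oD sf Dz).2.
apply: smooth_sum => // i _; apply: smooth_mul => //; first exact: smooth_cst.
exact: smooth_partial.
Qed.

Lemma derive_linear D f y : open D -> smooth_on D f -> D y ->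
  forall (c : R) u v, 'D_(c *: u + v) f y = c * 'D_u f y + 'D_v f y.
Proof.
move=> oD sf Dy c u v; have [_ E] := smooth_diff oD sf Dy.
rewrite !E mulr_sumr -big_split/=; apply: eq_bigr => i _.
by rewrite !mxE mulrDl mulrA.
Qed.

End Smooth.

Arguments smooth_derivable {R n} [D f y] v.
Arguments smooth_derive {R n} [D f] v.
Arguments smooth_partial {R n} [D f] i.
Arguments smooth_derivable_basis {R n} [D f y] i.

Section Composition.
Context {R : realType}.

(** Membership in such a class is how smoothness on E of a function of one
    variable is expressed: explicit families closed under differentiation stand
    in for the sequence of higher derivatives. *)
Definition derivation_closed (E : set R) (S : set (R -> R)) :=
  forall h, S h -> exists2 h', S h' & forall t, E t -> is_derive t 1 h (h' t).

Lemma derive_comp1 {n : nat} (f : 'rV[R]_n -> R) (h : R -> R) (dh : R) y v :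
  derivable f y v -> is_derive (f y) 1 h dh ->
  derivable (fun z => h (f z)) y v /\ 'D_v (fun z => h (f z)) y = dh * 'D_v f y.
Proof.
move=> df dhf.
have dl (F : 'rV[R]_n -> R) :
    derivable F y v <-> derivable (fun s : R => F (y + s *: v)) 0 1.
  rewrite derivable1P (_ : (fun s : R => F (y + s *: v)) = (fun s : R => F (s *: v + y)))//.
  by apply/funext => s; rewrite addrC.
have Dl (F : 'rV[R]_n -> R) : derivable F y v ->
    'D_v F y = 'D_1 (fun s : R => F (y + s *: v)) 0.
  have := @is_derive_line R _ _ F y v 0; rewrite scale0r addr0 => H /H[_ ->//].
have df0 := (dl f).1 df.
have dh0 : derivable h (f (y + 0 *: v)) 1 by rewrite scale0r addr0; case: dhf.
have dhfl : derivable (fun s : R => h (f (y + s *: v))) 0 1.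
  apply/derivable1_diffP; apply: (differentiable_comp (g := h)).
    by apply/derivable1_diffP; exact: df0.
  by apply/derivable1_diffP; exact: dh0.
have dhf' : derivable (fun z => h (f z)) y v by apply/dl.
have E := @derive1_comp R (fun s : R => f (y + s *: v)) h 0 df0 dh0.
rewrite !derive1E in E; split=> //; rewrite (Dl _ dhf') (Dl _ df).
etransitivity; first exact: E.
by rewrite scale0r addr0; case: dhf => _ ->.
Qed.

(** The generators are the smooth functions and all k o f with k in S; the
    chain rule sends k o f to a product of two generators. *)
Lemma smooth_comp {n : nat} (D : set 'rV[R]_n) (f : 'rV[R]_n -> R) (E : set R) (S : set
  (R -> R)) h :
  open D -> smooth_on D f -> (forall y, D y -> E (f y)) ->
  derivation_closed E S -> S h -> smooth_on D (fun z => h (f z)).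
Proof.
move=> oD sf fE cS Sh.
pose G := [set F | smooth_on D F \/ exists2 k, S k & F = (fun z => k (f z))].
apply: (smooth_coind (G := G)) => //; last first.
- by apply: generated_gen; right; exists h.
- move=> F i [sF|[k Sk ->]].
    split; first by move=> y Dy; exact: smooth_derivable_basis sF Dy.
    exists ('D_(basis_vector i) F) => //.
    by apply: generated_gen; left; exact: smooth_partial.
  have [k' Sk' kk'] := cS _ Sk.
  have dy y : D y -> _ := fun Dy => derive_comp1 (smooth_derivable_basis i sf Dy)
    (kk' _ (fE _ Dy)).
  split; first by move=> y /dy[].
  exists (fun z => k' (f z) * 'D_(basis_vector i) f z); last by move=> y /dy[].
  apply: generated_mul; apply: generated_gen; first by right; exists k'.
  by left; exact: smooth_partial.
- move=> F y [sF|[k Sk ->]] Dy; first exact: smooth_continuous sF Dy.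
  have [k' Sk' kk'] := cS _ Sk; have [dk _] := kk' _ (fE _ Dy).
  apply: (@continuous_comp _ _ _ f k); first exact: smooth_continuous sf Dy.
  exact/differentiable_continuous/derivable1_diffP.
Qed.

Lemma derivation_closed_inv :
  derivation_closed [set t | t != 0]
    [set h | exists (c : R) k, h = fun t => c * t ^- k].
Proof.
move=> _ [c [k ->]]; exists (fun t => (- c * k%:R) * t ^- k.+1).
  by exists (- c * k%:R), k.+1.
move=> t /= t0.
have tk0 : t ^+ k != 0 by rewrite expf_neq0.
have dV : is_derive t 1 (fun t => t ^- k) (- (k%:R * t ^- k.+1)).
  have dX := @exprn_derivable R k t 1.
  have dXV := @derivableV R R (fun s : R => s ^+ k) t 1 tk0 dX.
  have EXV := @deriveV R R (fun s : R => s ^+ k) t 1 tk0 dX.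
  split; first exact: dXV.
  rewrite EXV exp_derive /GRing.scale/= mulr1.
  case: k {tk0 dX dXV EXV} => [|k]; first by rewrite !mul0r mulr0 oppr0.
  have : t ^+ k != 0 by rewrite expf_neq0.
  rewrite /= [t ^+ k.+2]exprS [t ^+ k.+1]exprS; move: (t ^+ k) => b b0.
  have E : (t * (t * b))^-1 = (t * b) ^- 2 * b.
    by field; apply/andP.
  by rewrite E mulNr mulrCA.
have := is_deriveZ c dV; rewrite /GRing.scale/=.
by move=> dd; apply: is_derive_eq dd _; rewrite mulrN mulNr mulNr mulrA.
Qed.

Lemma smooth_inv {n : nat} (D : set 'rV[R]_n) (f : 'rV[R]_n -> R) :
  open D -> smooth_on D f -> (forall y, D y -> f y != 0) ->
  smooth_on D (fun z => (f z)^-1).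
Proof.
move=> oD sf f0; apply: (smooth_comp oD sf f0 derivation_closed_inv).
by exists 1, 1%N; apply/funext => t; rewrite mul1r expr1.
Qed.

End Composition.

Lemma derivable_shiftE {R : realType} {V W : normedModType R} (f : V -> W) (c x v : V) :
  derivable f (x + c) v -> derivable (fun z => f (z + c)) x v /\
  'D_v (fun z => f (z + c)) x = 'D_v f (x + c).
Proof.
have E : (fun h => h^-1 *: ((f \o shift (x + c)) (h *: v) - f (x + c)))
   = (fun h => h^-1 *: (((fun z => f (z + c)) \o shift x) (h *: v) - f (x + c))).
  by apply/funext => h /=; rewrite addrA.
by rewrite /derivable E => df; split => //; rewrite /derive E.
Qed.

Section Schwarz.
Context {R : realType} {n : nat}.
Implicit Types (D : set 'rV[R]_n) (f g : 'rV[R]_n -> R) (y v w : 'rV[R]_n).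

(** The mean value theorem is applied once along v and once along w.  The second
    difference is symmetric in v and w, whence the symmetry of second derivatives. *)
Lemma second_difference D f y v w (e : R) : open D -> smooth_on D f -> D y -> 0 < e ->
  exists2 d : R, 0 < d & forall t : R, 0 < t -> t < d ->
    `|f (y + t *: v + t *: w) - f (y + t *: v) - (f (y + t *: w) - f y)
      - t ^+ 2 * 'D_w ('D_v f) y| <= t ^+ 2 * e.
Proof.
move=> oD sf Dy e0.
have sv := smooth_derive v oD sf; have svw := smooth_derive w oD sv.
(* Both intermediate points lie in a ball of radius r on which D_w D_v f varies by at
   most e; the bound on t keeps y + s v + s' w in that ball for |s|, |s'| <= t. *)
have /cvgrPdist_le/(_ _ e0) cn := smooth_continuous svw Dy.
have [r /= r0 rP] := (nbhs_ballP _ _).1 (filterI (open_near oD Dy) cn).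
exists (r / (1 + `|v| + `|w|)).
  by rewrite divr_gt0// -addrA ltr_pwDl// addr_ge0.
move=> t t0; rewrite ltr_pdivlMr; last by rewrite -addrA ltr_pwDl// addr_ge0.
move=> td.
have inb (s s' : R) : `|s| <= `|t| -> `|s'| <= `|t| ->
    D (y + s *: v + s' *: w) /\
    `|'D_w ('D_v f) y - 'D_w ('D_v f) (y + s *: v + s' *: w)| <= e.
  move=> st s't; have [] := rP (y + s *: v + s' *: w); last by [].
  rewrite -ball_normE/= -addrA opprD addrA subrr sub0r normrN.
  apply: le_lt_trans td; rewrite (le_trans (ler_normD _ _))// !normrZ.
  rewrite (gtr0_norm t0) in st s't.
  rewrite !mulrDr mulr1 -addrA ler_wpDl ?(ltW t0)//.
  by apply: lerD; apply: ler_wpM2r.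
have inb0 (s : R) : `|s| <= `|t| -> D (y + s *: v).
  by move=> st; have := inb s 0 st; rewrite normr0 scale0r addr0 => -[].
have tt : `|t| <= `|t| by [].
have dF (s : R) : `|s| <= `|t| ->
    derivable (fun z => f (z + t *: w) - f z) (y + s *: v) v /\
    'D_v (fun z => f (z + t *: w) - f z) (y + s *: v) =
    'D_v f (y + s *: v + t *: w) - 'D_v f (y + s *: v).
  move=> st; have d1 := smooth_derivable v oD sf (inb _ _ st tt).1.
  have d2 := smooth_derivable v oD sf (inb0 _ st).
  have [d3 E] := derivable_shiftE d1.
  by split; [exact: (derivableB d3 d2)|rewrite (deriveB d3 d2) E].
have [|th tht E] := @mean_value_line R _ (fun z => f (z + t *: w) - f z) y v t.
  by move=> s /dF[].
have [|th' tht' E'] := @mean_value_line R _ ('D_v f) (y + th *: v) w t.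
  by move=> s st; apply: (smooth_derivable _ oD sv); have [] := inb _ _ tht st.
rewrite E (dF _ tht).2 E' mulrA -expr2 -mulrBr normrM ger0_norm ?sqr_ge0//.
by rewrite ler_wpM2l ?sqr_ge0// distrC (inb _ _ tht tht').2.
Qed.

Lemma derive_comm D f y v w : open D -> smooth_on D f -> D y ->
  'D_v ('D_w f) y = 'D_w ('D_v f) y.
Proof.
move=> oD sf Dy; apply/eqP; rewrite -subr_eq0 -normr_le0; apply/ler_addgt0Pl => e e0;
  rewrite addr0.
have e20 : 0 < e / 2 by rewrite divr_gt0.
have [d d0 dP] := second_difference v w oD sf Dy e20.
have [d' d'0 dP'] := second_difference w v oD sf Dy e20.
pose t := Num.min d d' / 2.
have m0 : 0 < Num.min d d' by rewrite lt_min d0.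
have t0 : 0 < t by rewrite divr_gt0.
have tm : t < Num.min d d' by rewrite ltr_pdivrMr// mulr2n mulrDr mulr1 ltrDl.
have [td td'] : t < d /\ t < d' by move: tm; rewrite lt_min => /andP.
have := dP t t0 td; have := dP' t t0 td'.
rewrite (addrAC y (t *: w)).
set A := f (y + _ + _); set B := f (y + t *: v); set C := f (y + t *: w).
set X := 'D_v _ y; set Y := 'D_w _ y.
move=> H1 H2.
have t20 : 0 < t ^+ 2 by rewrite exprn_gt0.
rewrite -(ler_pM2l t20) -[X in X * `|_|](gtr0_norm t20) -normrM.
have -> : t ^+ 2 * (X - Y) = (A - B - (C - f y) - t ^+ 2 * Y) - (A - C -
  (B - f y) - t ^+ 2 * X).
  by ring.
by rewrite (le_trans (ler_normB _ _))// (le_trans (lerD H2 H1))// -mulrDr -splitr.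
Qed.

End Schwarz.

Section Chain.
Context {R : realType}.

Lemma differentiable_row {V : normedModType R} {n : nat} (tau : V -> 'rV[R]_n) y :
  (forall j, differentiable (fun z => tau z 0 j) y) -> differentiable tau y.
Proof.
move=> dt; have -> : tau = \sum_j (fun z => tau z 0 j *: (delta_mx 0 j : 'rV[R]_n)).
  by apply/funext => z; rewrite fct_sumE [LHS]row_sum_delta.
by apply: differentiable_sum => j; apply: differentiableZl.
Qed.

Lemma derive_row {V : normedModType R} {n : nat} (tau : V -> 'rV[R]_n) y v :
  (forall j, derivable (fun z => tau z 0 j) y v) ->
  'D_v tau y = \row_j 'D_v (fun z => tau z 0 j) y.
Proof.
move=> dt; rewrite derive_mx; first by apply/rowP => j; rewrite !mxE.
by apply/derivable_mxP => i j; rewrite ord1.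
Qed.

Lemma chain_rule {V V' W : normedModType R} (tau : V -> V') (f : V' -> W) y v :
  differentiable tau y -> differentiable f (tau y) ->
  differentiable (f \o tau) y /\
  'D_v (f \o tau) y = 'D_('D_v tau y) f (tau y).
Proof.
move=> dt df; have dft : differentiable (f \o tau) y by apply: differentiable_comp.
split => //; rewrite !deriveE// diff_comp//=.
Qed.

End Chain.

(** * Two defining functions of the same hypersurface *)

Section BoundaryComparison.
Context {R : realType} {n : nat}.
Implicit Types (D : set 'rV[R]_n) (r s : 'rV[R]_n -> R) (y v w u : 'rV[R]_n).

(** The form in which a sign of the first or second derivative is turned into
    a sign of the function on a right neighbourhood of 0. *)
Lemma is_derive_neg (h : R -> R) (q : R) : h 0 = 0 -> is_derive (0 : R) 1 h q -> q < 0 ->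
  exists2 d : R, 0 < d & forall t, 0 < t -> t < d -> h t < 0.
Proof.
move=> h0 [dh hq] q0.
have C : (fun x => x^-1 * h x) @ 0^' --> q.
  have E : (fun x : R => x^-1 *: ((h \o shift (0 : R)) (x *: (1 : R)) - h 0)) =
      (fun x => x^-1 * h x).
    by apply/funext => x; rewrite /= h0 subr0 [x *: 1]mulr1 addr0.
  by move: dh hq; rewrite /derivable /derive E => + <-.
have q20 : 0 < - q / 2 by rewrite divr_gt0// oppr_gt0.
have /cvgrPdist_lt/(_ _ q20)[d /= d0 dP] := C.
exists d => // t t0 td; have := dP t; rewrite /= sub0r normrN gtr0_norm//.
move=> /(_ td (lt0r_neq0 t0)); rewrite ltr_norml => /andP[H1 _].
have : t^-1 * h t < 0 by lra.
by rewrite pmulr_rlt0// invr_gt0.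
Qed.

Lemma parabola_derive (y v w : 'rV[R]_n) (t : R) :
  let c := fun t : R => y + t *: v + t ^+ 2 *: w in
  differentiable c t /\ 'D_1 c t = v + (2 * t) *: w.
Proof.
move=> c.
have dj j : is_derive t 1 (fun t => c t 0 j) ((v + (2 * t) *: w) 0 j).
  have -> : (fun t => c t 0 j) = cst (y 0 j) + (v 0 j \*: id) + (w 0 j \*: (id ^+ 2)).
    apply/funext => x; rewrite /c !mxE.
    change (y 0 j + x * v 0 j + x ^+ 2 * w 0 j = y 0 j + v 0 j * x + w 0 j * x ^+ 2).
    by ring.
  apply: is_derive_eq; rewrite !mxE.
  change (0 + v 0 j * 1 + w 0 j * ((2 * t ^+ 1) * 1) = v 0 j + 2 * t * w 0 j).
  by ring.
have d : differentiable c t.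
  apply: differentiable_row => j; apply/derivable1_diffP; by case: (dj j).
split => //; rewrite derive_row; last by move=> j; case: (dj j).
by apply/rowP => j; rewrite mxE; case: (dj j).
Qed.

(** Along the parabola the second derivative of r at 0 is
    D_v D_v r + 2 D_w r, so w adjusts the second order term at will.  Parabolas
    replace the curves drawn on the hypersurface r = 0. *)
Lemma parabola_neg D r y v w : open D -> smooth_on D r -> D y -> r y = 0 ->
  'D_v r y = 0 -> 'D_v ('D_v r) y + 2 * 'D_w r y < 0 ->
  exists2 d : R, 0 < d & forall t, 0 < t -> t < d -> r (y + t *: v + t ^+ 2 *: w) < 0.
Proof.
move=> oD sr Dy ry rv q0.
pose c (t : R) := y + t *: v + t ^+ 2 *: w.
have c0 : c 0 = y by rewrite /c expr0n/= !scale0r !addr0.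
have dc t := parabola_derive y v w t.
have pull f t : smooth_on D f -> D (c t) ->
    is_derive t 1 (f \o c) ('D_v f (c t) + 2 * t * 'D_w f (c t)).
  move=> sf Dc; have [d1 E1] := dc t.
  have [d2 E2] := @chain_rule R _ _ _ c f t 1 d1 (smooth_diff oD sf Dc).1.
  split; first exact: diff_derivable.
  rewrite E2 E1 addrC; have [_ L] := smooth_diff oD sf Dc.
  by rewrite (derive_linear oD sf Dc) addrC.
pose psi' (t : R) := 'D_v r (c t) + 2 * t * 'D_w r (c t).
have [d d0 dP] : exists2 d : R, 0 < d & forall t, 0 < t -> t < d -> psi' t < 0.
  apply: (@is_derive_neg psi' ('D_v ('D_v r) y + 2 * 'D_w r y)) => //.
    by rewrite /psi' c0 rv mulr0 mul0r addr0.
  have Dc0 : D (c 0) by rewrite c0.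
  have H1 := pull ('D_v r) 0 (smooth_derive v oD sr) Dc0.
  have H2 := pull ('D_w r) 0 (smooth_derive w oD sr) Dc0.
  have H3 : is_derive (0 : R) 1 (fun t : R => 2 * t) 2.
    by apply: is_derive_eq; rewrite [LHS]mulr1.
  have H4 := is_deriveD H1 (is_deriveM H3 H2).
  apply: (is_derive_eq H4).
  change (('D_w r \o c) 0) with ('D_w r (c 0)); rewrite c0; move: ('D_v ('D_v r) y) ('D_w
    ('D_v r) y) ('D_w r y) => a1 a2 a3.
  move: ('D_v ('D_w r) y) ('D_w ('D_w r) y) => a4 a5.
  change (a1 + 2 * 0 * a2 + (2 * 0 * (a4 + 2 * 0 * a5) + a3 * 2) = a1 + 2 * a3).
  by ring.
have cc : {for 0, continuous c}.
  by apply: differentiable_continuous; case: (dc 0).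
have [e /= e0 eP] : \forall t \near (0 : R), D (c t).
  by apply: cc; rewrite c0; exact: open_near.
exists (Num.min d e); first by rewrite lt_min d0.
move=> t t0; rewrite lt_min => /andP[td te].
have Dc x : 0 <= x -> x <= t -> D (c x).
  move=> x0 xt; apply: eP; rewrite /= sub0r normrN ger0_norm//.
  exact: le_lt_trans xt te.
have [x|x|x] := @MVT R (r \o c) psi' 0 t t0.
- by rewrite in_itv/= => /andP[x0 xt]; apply: pull => //; apply: Dc; exact: ltW.
- apply: continuous_in_subspaceT x => x /set_mem /=; rewrite in_itv/= => /andP[x0 xt].
  apply/differentiable_continuous/derivable1_diffP.
  by have [] := pull r x sr (Dc _ x0 xt).
rewrite in_itv/= => /andP[x0 xt] /=; rewrite c0 ry !subr0 => ->.
by rewrite pmulr_llt0// dP// (lt_trans xt).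
Qed.

Lemma line_neg D r y w : open D -> smooth_on D r -> D y -> r y = 0 ->
  'D_w r y < 0 ->
  exists2 d : R, 0 < d & forall t, 0 < t -> t < d -> r (y + t *: w) < 0.
Proof.
move=> oD sr Dy ry rw.
apply: (@is_derive_neg (fun t => r (y + t *: w)) ('D_w r y)) => //.
  by rewrite scale0r addr0.
have := @is_derive_line R _ _ r y w 0; rewrite scale0r addr0; apply.
exact: smooth_derivable Dy.
Qed.

Variables (D : set 'rV[R]_n) (r s : 'rV[R]_n -> R) (y : 'rV[R]_n).
Hypotheses (oD : open D) (sr : smooth_on D r) (ss : smooth_on D s) (Dy : D y).
Hypotheses (ry : r y = 0) (sy : s y = 0).
Hypothesis rs : forall z, D z -> r z < 0 -> s z < 0.

Let near_D (c : R -> 'rV[R]_n) : c 0 = y -> {for 0, continuous c} ->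
  exists2 d : R, 0 < d & forall t, 0 < t -> t < d -> D (c t).
Proof.
move=> c0 cc; have [d /= d0 dP] : \forall t \near (0 : R), D (c t).
  by apply: cc; rewrite c0; exact: open_near.
by exists d => // t t0 td; apply: dP; rewrite /= sub0r normrN gtr0_norm.
Qed.

Let meet3 (P Q S : R -> Prop) : (exists2 d : R, 0 < d & forall t, 0 < t -> t < d -> P t) ->
  (exists2 d : R, 0 < d & forall t, 0 < t -> t < d -> Q t) ->
  (exists2 d : R, 0 < d & forall t, 0 < t -> t < d -> S t) ->
  exists t, [/\ P t, Q t & S t].
Proof.
move=> [d d0 dP] [e e0 eQ] [f f0 fS]; pose m := Num.min d (Num.min e f).
have m0 : 0 < m by rewrite !lt_min d0 e0.
have mm : m / 2 < m by rewrite ltr_pdivrMr// mulr2n mulrDr mulr1 ltrDl.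
have m20 : 0 < m / 2 by rewrite divr_gt0.
move: mm; rewrite {2}/m !lt_min => /and3P[md me mf].
by exists (m / 2); split; [exact: dP|exact: eQ|exact: fS].
Qed.

Let opp_derive f v : smooth_on D f -> 'D_v (fun z => - f z) y = - 'D_v f y.
Proof. by move=> sf; exact: deriveN (smooth_derivable v oD sf Dy). Qed.

Let first_order w : 'D_w r y < 0 -> 'D_w s y <= 0.
Proof.
move=> rw; rewrite leNgt; apply/negP => sw.
have [||||t [rt st Dt]] := meet3 (line_neg oD sr Dy ry rw)
  (line_neg (w := w) oD (smooth_opp oD ss) Dy _ _)
  (near_D (c := fun t => y + t *: w) _ _).
- by rewrite sy oppr0.
- by rewrite opp_derive// oppr_lt0.
- by rewrite scale0r addr0.
- apply/differentiable_continuous.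
  have [+ _] := parabola_derive y w 0 0.
  by rewrite (_ : (fun t => _) = fun t : R => y + t *: w)//;
    apply/funext => t; rewrite scaler0 addr0.
by have := rs Dt rt; rewrite ltNge ltW// -oppr_lt0.
Qed.

(** The half-space where the differential of r is negative is mapped into the
    one where that of s is nonpositive ([first_order]); this forces the two
    differentials to be positively proportional. *)
Lemma boundary_covector : (exists w, 'D_w r y != 0) -> (exists w, 'D_w s y != 0) ->
  exists2 lam : R, 0 < lam & forall w, 'D_w s y = lam * 'D_w r y.
Proof.
move=> [u0 ru0] [w0 sw0].
have rL := derive_linear oD sr Dy; have sL := derive_linear oD ss Dy.
pose u := - ('D_u0 r y)^-1 *: u0.
have rZ c w : 'D_(c *: w) r y = c * 'D_w r y.
  by rewrite -[c *: w]addr0 rL derive0 addr0.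
have ru : 'D_u r y = -1 by rewrite rZ mulNr mulVf.
(* The coefficient below would push the derivative of s to 1 while that of r is -1. *)
have sker w : 'D_w r y = 0 -> 'D_w s y = 0.
  move=> rw; apply/eqP; apply: contraT => sw.
  have : 'D_(((1 - 'D_u s y) / 'D_w s y) *: w + u) s y <= 0.
    by apply: first_order; rewrite rL rw mulr0 add0r ru ltrN10.
  by rewrite sL divfK// subrK ler10.
have sE w : 'D_w s y = - 'D_u s y * 'D_w r y.
  have : 'D_('D_w r y *: u + w) s y = 0.
    by apply: sker; rewrite rL ru mulrN1 addNr.
  rewrite sL => /eqP; rewrite addrC addr_eq0 => /eqP ->.
  by rewrite mulrC mulNr.
exists (- 'D_u s y) => //.
rewrite lt_neqAle oppr_ge0 first_order ?ru ?ltrN10// andbT eq_sym.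
by apply: contraNneq sw0 => l0; rewrite sE l0 mul0r.
Qed.

(** Otherwise some multiple w of a transversal vector makes the parabola
    y + t v + t^2 w enter both r < 0 and s > 0 for small t > 0. *)
Lemma boundary_second_order (lam : R) v : 0 < lam ->
  (exists w, 'D_w r y != 0) ->
  (forall w, 'D_w s y = lam * 'D_w r y) -> 'D_v r y = 0 ->
  'D_v ('D_v s) y <= lam * 'D_v ('D_v r) y.
Proof.
move=> l0 [u0 ru0] sE rv; rewrite leNgt; apply/negP => lt_As.
have [sg sgA sgB] : exists2 sg, 'D_v ('D_v r) y + 2 * - sg < 0 &
    - 'D_v ('D_v s) y + 2 * - (lam * - sg) < 0.
  move: ('D_v ('D_v r) y) ('D_v ('D_v s) y) lt_As => A B AB.
  have {}AB : A < B / lam by rewrite ltr_pdivlMr// mulrC.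
  (* Half the midpoint of A and B / lam: the second order terms become
     (A - B / lam) / 2 < 0 for r and its multiple by lam > 0 for - s. *)
  exists ((A + B / lam) / 4); first by lra.
  have -> : - B + 2 * - (lam * - ((A + B / lam) / 4)) = lam / 2 * (A - B / lam).
    by field; rewrite gt_eqF.
  by rewrite pmulr_rlt0 ?divr_gt0// subr_lt0.
have rL := derive_linear oD sr Dy.
pose w := - (sg / 'D_u0 r y) *: u0.
have rw : 'D_w r y = - sg.
  by rewrite /w -[_ *: u0]addr0 rL derive0 addr0 mulNr divfK.
have sv : 'D_v s y = 0 by rewrite sE rv mulr0.
rewrite -{}rw in sgA sgB; rewrite -sE in sgB.
have ND : 'D_v ('D_v (fun z => - s z)) y = - 'D_v ('D_v s) y.
  rewrite -(opp_derive v (smooth_derive v oD ss)).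
  apply: near_eq_derive; apply: filterS (open_near oD Dy) => z Dz.
  exact: deriveN (smooth_derivable v oD ss Dz).
have [|||||t [rt st Dt]] := meet3 (parabola_neg oD sr Dy ry rv sgA)
  (parabola_neg (v := v) (w := w) oD (smooth_opp oD ss) Dy _ _ _)
  (near_D (c := fun t => y + t *: v + t ^+ 2 *: w) _ _).
- by rewrite sy oppr0.
- by rewrite opp_derive// sv oppr0.
- by rewrite ND opp_derive.
- by rewrite expr0n/= !scale0r !addr0.
- by apply/differentiable_continuous; case: (parabola_derive y v w 0).
by have := rs Dt rt; rewrite ltNge ltW// -oppr_lt0.
Qed.

End BoundaryComparison.

(** * Functions of one variable *)

Section NegLog.
Context {R : realType}.

Definition neglog (t : R) : R := - ln (- t).

Lemma is_derive_neglog (t : R) : t < 0 -> is_derive t 1 neglog (- t^-1).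
Proof.
move=> t0; have mt0 : 0 < - t by rewrite oppr_gt0.
have H1 : is_derive t 1 (-%R : R -> R) (- 1) by exact: is_deriveNid.
have H2 := is_derive1_ln mt0.
have := is_deriveN (is_derive1_comp H2 H1).
by move=> H; apply: is_derive_eq H _; rewrite invrN mulrN1 opprK.
Qed.

Lemma is_derive_invr (t : R) : t != 0 -> is_derive t 1 (fun t : R => t^-1) (- t^-1 ^+ 2).
Proof.
move=> t0; have H := @is_deriveV R (fun t : R => t) t 1 1 t0 (is_derive_id _ _).
by apply: is_derive_eq H _; rewrite [_ *: _]mulr1 exprVn.
Qed.

Lemma is_derive_neglog2 (t : R) : t < 0 -> is_derive t 1 (fun t : R => - t^-1) (t^-1 ^+ 2).
Proof.
move=> t0; have tn0 : t != 0 by rewrite lt_eqF.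
by apply: is_derive_eq (is_deriveN (is_derive_invr tn0)) _; rewrite opprK.
Qed.

Definition neglog_class : set (R -> R) :=
  [set h | h = neglog \/ exists (c : R) k, h = fun t => c * t ^- k].

Lemma derivation_closed_neglog : derivation_closed [set t : R | t < 0] neglog_class.
Proof.
move=> h [->|hc].
  exists (fun t => - t^-1); last by move=> t; exact: is_derive_neglog.
  by right; exists (-1), 1%N; apply/funext => t; rewrite mulN1r expr1.
have [h' h'c h'd] := derivation_closed_inv hc.
by exists h'; [right|move=> t t0; apply: h'd; rewrite /= lt_eqF].
Qed.

End NegLog.

Section Flat.
Context {R : realType}.

(** Smoothness of exp(-1/t) at 0 is proved for this whole family at once: it is
    stable under differentiation, unlike its member P = 1. *)
Definition flat (P : {poly R}) (t : R) : R :=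
  if 0 < t then P.[t^-1] * expR (- t^-1) else 0.

(** With u = 1/t, the exponential beats the polynomial:
    exp u >= u^(m+2) / (m+2)! where m bounds the degree of P.  Quadratic decay
    suffices to see that the derivative at 0 exists and vanishes. *)
Lemma flat_bound (P : {poly R}) : exists2 K : R, 0 <= K &
  forall t, `|t| <= 1 -> `|flat P t| <= K * t ^+ 2.
Proof.
pose m := size P; pose A := \sum_(i < m) `|P`_i|.
have A0 : 0 <= A by exact: sumr_ge0.
exists (A * (m.+2)`!%:R); first by rewrite mulr_ge0.
move=> t t1; rewrite /flat; case: ifPn => [t0|_]; last first.
  by rewrite normr0 mulr_ge0 ?sqr_ge0// mulr_ge0.
have u1 : 1 <= t^-1 by rewrite invf_ge1// -(gtr0_norm t0).
set u := t^-1 in u1 *; have u0 : 0 < u by rewrite invr_gt0.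
have Pu : `|P.[u]| <= A * u ^+ m.
  rewrite horner_coef (le_trans (ler_norm_sum _ _ _))// mulr_suml ler_sum// => i _.
  rewrite normrM ler_wpM2l// normrX (gtr0_norm u0) ler_weXn2l//.
  exact: ltnW.
have eu : expR (- u) <= (m.+2)`!%:R * u ^- m.+2.
  have := expR_ge1Dxn m.+1 (ltW u0) => H.
  have f0 : 0 < (m.+2)`!%:R :> R by rewrite ltr0n fact_gt0.
  have H2 : u ^+ m.+2 / (m.+2)`!%:R <= expR u by apply: le_trans H; rewrite lerDr.
  rewrite expRN -[leRHS]invrK lef_pV2 ?posrE ?expR_gt0//; last first.
    by rewrite invr_gt0 mulr_gt0// invr_gt0 exprn_gt0.
  by rewrite invfM invrK mulrC.
rewrite normrM (gtr0_norm (expR_gt0 _)).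
apply: le_trans (ler_pM _ _ Pu eu) _; rewrite ?expR_ge0//.
have um0 : u ^+ m != 0 by rewrite expf_neq0// gt_eqF.
have -> : t ^+ 2 = u ^- 2 by rewrite /u -exprVn invrK.
rewrite (_ : u ^+ m.+2 = u ^+ m * u ^+ 2); last by rewrite -exprD addn2.
move: (u ^+ m) um0 => b b0; move: ((m.+2)`!%:R) => N.
rewrite le_eqVlt; apply/orP; left; apply/eqP.
by field; rewrite b0 gt_eqF.
Qed.

(** The derivative of P(1/t) exp(-1/t) is (1/t)^2 (P - P')(1/t) exp(-1/t). *)
Definition flat_derivative (P : {poly R}) : {poly R} := 'X^2 * (P - P^`()).

Lemma is_derive_flat (P : {poly R}) (t : R) :
  is_derive t 1 (flat P) (flat (flat_derivative P) t).
Proof.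
have [t0|t0|->] := ltgtP t 0.
- rewrite {2}/flat ltNge (ltW t0)/=.
  apply: (@near_eq_is_derive R R R (fun=> 0)).
  apply: filterS (open_nbhs_nbhs (conj (@open_lt R 0) t0)) => s /= s0.
  by rewrite /flat ltNge (ltW s0).
- rewrite {2}/flat t0.
  apply: (@near_eq_is_derive R R R (fun t => P.[t^-1] * expR (- t^-1))).
    apply: filterS (open_nbhs_nbhs (conj (@open_gt R 0) t0)) => s /= s0.
    by rewrite /flat s0.
  have Hi := is_derive_invr (lt0r_neq0 t0).
  have H1 := is_derive1_comp (is_derive_poly P t^-1) Hi.
  have H2 := @is_derive1_comp R expR (fun s => - s^-1) t _ _ (is_derive_expR (- t^-1))
    (is_deriveN Hi).
  apply: is_derive_eq (is_deriveM H1 H2) _.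
  rewrite /flat_derivative !hornerE.
  change (P.[t^-1] * (expR (- t^-1) * - - t^-1 ^+ 2) + expR (- t^-1) *
    (P^`().[t^-1] * - t^-1 ^+ 2)
    = t^-1 ^+ 2 * (P.[t^-1] - P^`().[t^-1]) * expR (- t^-1)).
  by move: (t^-1) => u; move: (P.[u]) (P^`().[u]) (expR (- u)) => b c d; ring.
- have f0 Q : flat Q 0 = 0 by rewrite /flat ltxx.
  rewrite f0; have [K K0 HK] := flat_bound P.
  have E : (fun x : R => x^-1 *: ((flat P \o shift (0 : R)) (x *: (1 : R)) - flat P 0)) =
      (fun x => x^-1 * flat P x).
    by apply/funext => x; rewrite /= f0 subr0 [x *: 1]mulr1 addr0.
  have C : (fun x => x^-1 * flat P x) @ 0^' --> (0 : R).
    apply/cvgrPdist_le => e e0; near=> x.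
    rewrite sub0r normrN normrM normfV.
    have x0 : x != 0 by near: x; exact: nbhs_dnbhs_neq.
    have x1 : `|x| <= 1 by near: x; exact: dnbhs0_le.
    have xe : `|x| <= e / (K + 1).
      by near: x; apply: dnbhs0_le; rewrite divr_gt0// ltr_wpDl.
    rewrite ler_pdivrMl ?normr_gt0//; apply: (le_trans (HK _ x1)).
    rewrite -[x ^+ 2]real_normK ?num_real// expr2 mulrA mulrC ler_wpM2l//.
    apply: (le_trans (ler_wpM2l K0 xe)).
    by rewrite mulrA ler_pdivrMr ?ltr_wpDl// mulrDr mulr1 mulrC lerDl ltW.
  by split; [rewrite /derivable E; apply/cvg_ex; exists 0|rewrite /derive E; exact: cvg_lim C].
Unshelve. all: by end_near. Qed.

(** The factor t makes the function unbounded, without which composing with it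
    would destroy exhaustion; it stays convex and vanishes for t <= 0. *)
Definition cutoff (t : R) : R := t * flat 1 t.

Lemma is_derive_cutoff (t : R) : is_derive t 1 cutoff (flat (1 + 'X) t).
Proof.
have := is_deriveM (is_derive_id t 1) (is_derive_flat 1 t).
move=> H; apply: is_derive_eq H _.
change (t * flat (flat_derivative 1) t + flat 1 t * 1 = flat (1 + 'X) t).
rewrite /flat; case: ifPn => [t0|_]; last by rewrite mulr0 mul0r addr0.
have -> : flat_derivative 1 = 'X^2 by rewrite /flat_derivative derivC subr0 mulr1.
rewrite hornerD hornerXn hornerX !hornerC.
by have tn0 := lt0r_neq0 t0; move: (expR _) => d; field.
Qed.

Lemma is_derive_cutoff2 (t : R) : is_derive t 1 (flat (1 + 'X)) (flat 'X^3 t).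
Proof.
apply: is_derive_eq (is_derive_flat _ _) _; congr (flat _ t).
rewrite /flat_derivative derivD derivC derivX; ring.
Qed.

Definition flat_class (c : R) : set (R -> R) :=
  [set h | h = (fun t => cutoff (t - c)) \/ exists P, h = (fun t => flat P (t - c))].

Lemma is_derive_shiftN (h : R -> R) (c t dh : R) :
  is_derive (t - c) 1 h dh -> is_derive t 1 (fun t => h (t - c)) dh.
Proof.
move=> H; have Hs : is_derive t 1 (fun t : R => t - c) 1.
  have Hb := is_deriveB (is_derive_id t 1) (is_derive_cst c t 1).
  by apply: is_derive_eq Hb _; rewrite subr0.
have [d E] := @is_derive1_comp R h (fun t => t - c) t _ _ H Hs.
by split; [exact: d|apply: (etrans E); exact: mulr1].
Qed.

Lemma derivation_closed_flat c : derivation_closed [set: R] (flat_class c).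
Proof.
move=> h [->|[P ->]].
  exists (fun t => flat (1 + 'X) (t - c)); first by right; exists (1 + 'X).
  by move=> t _; apply: is_derive_shiftN; exact: is_derive_cutoff.
exists (fun t => flat (flat_derivative P) (t - c)).
  by right; exists (flat_derivative P).
by move=> t _; apply: is_derive_shiftN; exact: is_derive_flat.
Qed.

Lemma flat_le0 P (t : R) : t <= 0 -> flat P t = 0.
Proof. by rewrite /flat leNgt; case: ifP. Qed.

Lemma cutoff_le0 (t : R) : t <= 0 -> cutoff t = 0.
Proof. by move=> t0; rewrite /cutoff flat_le0// mulr0. Qed.

Lemma cutoff_derive_gt0 (t : R) : 0 < t -> 0 < flat (1 + 'X) t.
Proof.
move=> t0; rewrite /flat t0 !hornerE mulr_gt0 ?expR_gt0//.
by rewrite addr_gt0// invr_gt0.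
Qed.

Lemma cutoff_derive2_ge0 (t : R) : 0 <= flat 'X^3 t.
Proof.
rewrite /flat; case: ifPn => // t0; rewrite hornerXn mulr_ge0 ?expR_ge0//.
by rewrite exprn_ge0// invr_ge0 ltW.
Qed.

(** For t > 1 the cutoff is at least t / exp 1. *)
Lemma cutoff_bounded (c t : R) : cutoff t <= c -> t <= 1 + `|c| * expR 1.
Proof.
rewrite leNgt; apply: contraNle => H.
have t1 : 1 < t by apply: le_lt_trans H; rewrite lerDl mulr_ge0// expR_ge0.
have t0 : 0 < t := lt_trans ltr01 t1.
rewrite /cutoff /flat t0 hornerC mul1r.
apply: (le_lt_trans (ler_norm c)).
have : `|c| * expR 1 < t by apply: le_lt_trans H; rewrite lerDr.
rewrite -ltr_pdivlMr ?expR_gt0// => /lt_le_trans; apply.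
rewrite -expRN ler_wpM2l ?(ltW t0)// ler_expR lerN2 invf_le1//.
exact: ltW.
Qed.

End Flat.

(** * Alternating forms and orthonormal frames *)

Section SetRow.
Context {R : realType} {p n : nat}.
Implicit Types (v : 'M[R]_(p, n)) (u w : 'rV[R]_n) (i j : 'I_p).

Lemma row_set_row i w v k : row k (set_row i w v) = if k == i then w else row k v.
Proof.
by apply/rowP => j; rewrite !mxE; case: eqP => // _; rewrite mxE.
Qed.

Lemma set_row_id i v : set_row i (row i v) v = v.
Proof. by apply/matrixP => k j; rewrite !mxE; case: eqP => // ->. Qed.

Lemma set_row_set_row i u w v : set_row i u (set_row i w v) = set_row i u v.
Proof. by apply/matrixP => k j; rewrite !mxE; case: eqP. Qed.

Lemma set_rowC i j u w v : i != j ->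
  set_row i u (set_row j w v) = set_row j w (set_row i u v).
Proof.
move=> ij; apply/matrixP => k l; rewrite !mxE.
by case: eqP => // ->; rewrite (negbTE ij).
Qed.

End SetRow.

Lemma mul_set_row {R : realType} {p n m : nat} (i : 'I_p) (w : 'rV[R]_n)
    (v : 'M[R]_(p, n)) (J : 'M[R]_(n, m)) :
  set_row i w v *m J = set_row i (w *m J) (v *m J).
Proof.
by apply/row_matrixP => k; rewrite row_mul !row_set_row row_mul; case: eqP.
Qed.

Section Multilinear.
Context {R : realType} {p n : nat}.
Implicit Types (F : 'M[R]_(p, n) -> R) (v e : 'M[R]_(p, n)) (u w : 'rV[R]_n) (i j : 'I_p).

Definition multilinear F := forall v i (c : R) u w,
  F (set_row i (c *: u + w) v) = c * F (set_row i u v) + F (set_row i w v).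

Definition row_alternating F := forall v i j, i != j -> row i v = row j v -> F v = 0.

Lemma multilinear0 F v i : multilinear F -> F (set_row i 0 v) = 0.
Proof.
move=> /(_ v i 1 0 0); rewrite scale1r addr0 mul1r => /eqP.
by rewrite -subr_eq0 opprD addNKr oppr_eq0 => /eqP.
Qed.

Lemma multilinearZ F v i c u : multilinear F ->
  F (set_row i (c *: u) v) = c * F (set_row i u v).
Proof. by move=> mF; rewrite -[c *: u]addr0 mF multilinear0// addr0. Qed.

Lemma multilinearD F v i u w : multilinear F ->
  F (set_row i (u + w) v) = F (set_row i u v) + F (set_row i w v).
Proof. by move=> mF; rewrite -[u]scale1r mF scale1r mul1r. Qed.

Lemma multilinear_sum F v i (I : Type) (r : seq I) (P : pred I) (c : I -> R)
    (u : I -> 'rV[R]_n) : multilinear F ->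
  F (set_row i (\sum_(k <- r | P k) c k *: u k) v) =
  \sum_(k <- r | P k) c k * F (set_row i (u k) v).
Proof.
move=> mF; elim: r => [|k r IH]; first by rewrite !big_nil multilinear0.
by rewrite !big_cons; case: ifP => // _; rewrite mF IH.
Qed.

Lemma alternating_swap F v i j u w : multilinear F -> row_alternating F -> i != j ->
  F (set_row i u (set_row j w v)) = - F (set_row i w (set_row j u v)).
Proof.
move=> mF aF ij; apply/eqP; rewrite -addr_eq0.
have E x y : F (set_row i (x + y) (set_row j (x + y) v)) = 0.
  by apply: (aF _ i j) => //; rewrite !row_set_row eqxx eq_sym (negbTE ij) eqxx.
have E1 x : F (set_row i x (set_row j x v)) = 0 by have := E x 0; rewrite addr0.
have := E u w; rewrite multilinearD// !(set_rowC _ _ _ ij) !multilinearD//.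
by rewrite -!(set_rowC _ _ _ ij) !E1 add0r addr0 addrC => ->.
Qed.

(** The derivative at s = 0 of F((1 + s L) v).  The phi-Hessian is the case
    where F is phi and L maps v to nabla_v (grad f). *)
Definition derivation_form F (L : 'rV[R]_n -> 'rV[R]_n) v : R :=
  \sum_i F (set_row i (L (row i v)) v).

Lemma derivation_form_multilinear F (L : 'rV[R]_n -> 'rV[R]_n) :
  (forall c u w, L (c *: u + w) = c *: L u + L w) ->
  multilinear F -> multilinear (derivation_form F L).
Proof.
move=> lL mF v i c u w; rewrite /derivation_form mulr_sumr -big_split/=.
apply: eq_bigr => k _; rewrite !row_set_row; case: eqVneq => [->|ki].
  by rewrite !set_row_set_row lL mF.
by rewrite !(set_rowC _ _ _ ki) mF.
Qed.

(** Being alternating, the derivation form only depends on the p-vector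
    represented by v; so an arbitrary frame of a phi-plane may be replaced by an
    orthonormal one. *)
Lemma derivation_form_alternating F (L : 'rV[R]_n -> 'rV[R]_n) :
  multilinear F -> row_alternating F -> row_alternating (derivation_form F L).
Proof.
move=> mF aF v i j ij vij; rewrite /derivation_form (bigD1 i)//= (bigD1 j) 1?eq_sym//=.
rewrite big1 ?addr0 => [|k /andP[ki kj]].
  have vj : set_row j (row i v) v = v by rewrite vij set_row_id.
  have := alternating_swap v (L (row i v)) (row i v) mF aF ij.
  by rewrite vj -vij => ->; rewrite set_rowC// set_row_id addNr.
apply: (aF _ i j) => //; rewrite !row_set_row.
by rewrite eq_sym (negbTE ki) eq_sym (negbTE kj).
Qed.

End Multilinear.

Lemma linear_form_sum {R : realType} {n : nat} (K : 'rV[R]_n -> R) u :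
  (forall c u w, K (c *: u + w) = c * K u + K w) ->
  K u = \sum_j u 0 j * K (delta_mx 0 j).
Proof.
move=> lK; rewrite {1}[u]row_sum_delta; elim: (index_enum _) => [|j s IH].
  have := lK 1 0 0; rewrite !big_nil scale1r addr0 mul1r => /eqP.
  by rewrite -subr_eq0 opprD addNKr oppr_eq0 => /eqP.
by rewrite !big_cons lK IH.
Qed.

Section Gram.
Context {R : realType} {n : nat}.
Variable (G : 'M[R]_n).
Hypothesis symG : G^T = G.
Hypothesis posG : forall v : 'rV[R]_n, v != 0 -> 0 < (v *m G *m v^T) 0 0.
Implicit Types (u v w : 'rV[R]_n).

Definition ip u w : R := (u *m G *m w^T) 0 0.

Lemma ipDl (c : R) u v w : ip (c *: u + v) w = c * ip u w + ip v w.
Proof. by rewrite /ip !mulmxDl -!scalemxAl !mxE. Qed.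

Lemma ipC u w : ip u w = ip w u.
Proof.
rewrite /ip; have -> : u *m G *m w^T = (w *m G *m u^T)^T.
  by rewrite !trmx_mul trmxK symG mulmxA.
by rewrite mxE.
Qed.

Lemma ipDr (c : R) u v w : ip w (c *: u + v) = c * ip w u + ip w v.
Proof. by rewrite ipC ipDl !(ipC _ w). Qed.

Lemma ip0l w : ip 0 w = 0. Proof. by rewrite /ip !mul0mx mxE. Qed.

Lemma ipZl c u w : ip (c *: u) w = c * ip u w.
Proof. by rewrite -[c *: u]addr0 ipDl ip0l addr0. Qed.

Lemma ipZr c u w : ip w (c *: u) = c * ip w u.
Proof. by rewrite ipC ipZl ipC. Qed.

Lemma ip_ge0 u : 0 <= ip u u.
Proof. by have [->|u0] := eqVneq u 0; rewrite ?ip0l// ltW// posG. Qed.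

Lemma ip_suml (I : Type) (r : seq I) (P : pred I) (c : I -> R) (u : I -> 'rV[R]_n) w :
  ip (\sum_(k <- r | P k) c k *: u k) w = \sum_(k <- r | P k) c k * ip (u k) w.
Proof.
elim: r => [|k r IH]; first by rewrite !big_nil ip0l.
by rewrite !big_cons; case: ifP => // _; rewrite ipDl IH.
Qed.

Lemma gramE p (v w : 'M[R]_(p, n)) i j :
  (v *m G *m w^T) i j = ip (row i v) (row j w).
Proof.
by rewrite /ip -row_mul !mxE; apply: eq_bigr => k _; rewrite !mxE.
Qed.

Lemma gram_multilinear p (w : 'M[R]_(p, n)) :
  multilinear (fun v : 'M[R]_(p, n) => \det (v *m G *m w^T)).
Proof.
move=> v i c u x.
pose A y := set_row i y v *m G *m w^T.
have Ai y : row i (A y) = y *m G *m w^T.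
  by rewrite !row_mul row_set_row eqxx.
have A' y z : row' i (A y) = row' i (A z).
  apply/row_matrixP => k; rewrite !row_rowsub.
  by rewrite !row_mul !row_set_row eq_sym (negbTE (neq_lift _ _)).
rewrite -[X in _ = _ + X]mul1r.
apply: (determinant_multilinear (i0 := i)); [|exact: A'|exact: A'].
by rewrite !Ai !mulmxDl -!scalemxAl scale1r.
Qed.

Lemma gram_alternating p (w : 'M[R]_(p, n)) :
  row_alternating (fun v : 'M[R]_(p, n) => \det (v *m G *m w^T)).
Proof.
move=> v i j ij vij; apply: (determinant_alternate ij) => k.
by rewrite !gramE vij.
Qed.

(** Adding to a row a combination of the others does not change an alternating
    form, and normalizing a row multiplies it by a positive factor.  Quantifying
    over all forms records how the new frame is related to the old one. *)
Lemma Gram_Schmidt_step p (v : 'M[R]_(p, n)) : \det (v *m G *m v^T) != 0 ->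
  forall k, (k <= p)%N -> exists u : 'M[R]_(p, n), (exists2 s : R, 0 < s &
    forall F, multilinear F -> row_alternating F -> F u = s * F v) /\
    forall i j : 'I_p, (i < k)%N -> (j < k)%N -> ip (row i u) (row j u) = (i == j)%:R.
Proof.
move=> dv; elim=> [_|k IH kp].
  by exists v; split => //; exists 1 => // F _ _; rewrite mul1r.
have [u [[s s0 us] ou]] := IH (ltnW kp); pose i0 := Ordinal kp.
pose c (j : 'I_p) := if (j < k)%N then - ip (row i0 u) (row j u) else 0.
pose r := row i0 u + \sum_j c j *: row j u.
have rE F : multilinear F -> row_alternating F -> F (set_row i0 r u) = F u.
  move=> mF aF; rewrite multilinearD// set_row_id multilinear_sum//.
  rewrite big1 ?addr0// => j _; rewrite /c; case: ifP => jk; last by rewrite mul0r.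
  rewrite (aF _ j i0) ?mulr0//.
    by apply: contraTN jk => /eqP ->; rewrite /= ltnn.
  rewrite !row_set_row eqxx; case: eqP => // _.
have ro (j : 'I_p) : (j < k)%N -> ip r (row j u) = 0.
  move=> jk; rewrite /r -[row i0 u]scale1r ipDl ip_suml mul1r.
  rewrite (bigD1 j)//= big1 => [|l lj].
    by rewrite /c jk (ou j j)// eqxx mulr1 addr0 subrr.
  by rewrite /c; case: ifP => lk; rewrite ?mul0r// (ou l j)// (negbTE lj) mulr0.
have r0 : r != 0.
  apply/eqP => r0.
  have := rE _ (gram_multilinear v) (gram_alternating v).
  rewrite r0 (multilinear0 _ _ (gram_multilinear v)).
  rewrite (us _ (gram_multilinear v) (gram_alternating v)) => /esym/eqP.
  by rewrite mulf_eq0 (negbTE dv) orbF (gt_eqF s0).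
pose q := Num.sqrt (ip r r).
have q0 : 0 < q by rewrite sqrtr_gt0 posG.
have q2 : q ^+ 2 = ip r r by rewrite sqr_sqrtr// ip_ge0.
exists (set_row i0 (q^-1 *: r) u); split.
  exists (q^-1 * s); first by rewrite mulr_gt0// invr_gt0.
  by move=> F mF aF; rewrite multilinearZ// rE// us// mulrA.
have ltk (i : 'I_p) : (i < k.+1)%N -> i != i0 -> (i < k)%N.
  by rewrite ltnS leq_eqVlt => /orP[/eqP ik|//] /eqP ii; case: ii; exact/val_inj.
move=> i j ik jk; rewrite !row_set_row; have [->|ii] := eqVneq i i0;
  have [jE|jj] := eqVneq j i0.
- by rewrite ipZl ipZr -q2 expr2 mulKf ?mulVf ?gt_eqF.
- by rewrite ipZl ro ?ltk// mulr0.
- by rewrite ipZr ipC ro ?ltk// mulr0 jE (negbTE ii).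
- by rewrite ou ?ltk.
Qed.

(** The factor s of [Gram_Schmidt_step] is 1: the Gram determinant is itself an
    alternating form of either frame, and it equals 1 for both. *)
Lemma Gram_Schmidt p (v : 'M[R]_(p, n)) : \det (v *m G *m v^T) = 1 ->
  exists2 u : 'M[R]_(p, n), u *m G *m u^T = 1%:M &
    forall F, multilinear F -> row_alternating F -> F u = F v.
Proof.
move=> dv; have [|u [[s s0 us] ou]] := @Gram_Schmidt_step p v _ p (leqnn p).
  by rewrite dv oner_eq0.
have uG : u *m G *m u^T = 1%:M.
  by apply/matrixP => i j; rewrite gramE ou ?ltn_ord// mxE.
exists u => // F mF aF; rewrite us//; suff -> : s = 1 by rewrite mul1r.
have := us _ (gram_multilinear u) (gram_alternating u); rewrite uG det1.
have -> : v *m G *m u^T = (u *m G *m v^T)^T.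
  by rewrite !trmx_mul trmxK symG mulmxA.
rewrite det_tr (us _ (gram_multilinear v) (gram_alternating v)) dv mulr1.
move=> /esym/eqP; rewrite -expr2 sqrf_eq1 => /orP[/eqP//|/eqP sN].
by move: s0; rewrite sN oppr_gt0 ltr10.
Qed.

Section Comass.
Context {p : nat} (F : 'M[R]_(p, n) -> R).
Hypothesis mF : multilinear F.
Hypothesis aF : row_alternating F.
Hypothesis F_le1 : forall v : 'M[R]_(p, n), \det (v *m G *m v^T) = 1 -> F v <= 1.

(** Turning e_i towards w stays among unit simple p-vectors up to a length of
    second order, and F is maximal at e: its first variation vanishes. *)
Lemma first_cousin (e : 'M[R]_(p, n)) i w : e *m G *m e^T = 1%:M -> F e = 1 ->
  (forall j, ip w (row j e) = 0) -> F (set_row i w e) = 0.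
Proof.
move=> oe Fe we.
have ee j k : ip (row j e) (row k e) = (j == k)%:R by rewrite -gramE oe mxE.
(* Moving e_i by t w, the gain t c beats the loss of order t^2 W for this small t. *)
set c := F _; pose W := ip w w; pose D := W + c ^+ 2 + 1; pose t := c / D.
have W0 : 0 <= W := ip_ge0 w.
have D0 : 0 < D by rewrite ltr_wpDl// addr_ge0// sqr_ge0.
pose x := t *: w + row i e.
have xe j : ip x (row j e) = (i == j)%:R by rewrite ipDl we mulr0 add0r ee.
have xx : ip x x = 1 + t ^+ 2 * W.
  rewrite {2}/x ipDr [ip x w]ipC /x ipDr xe eqxx [ip w (row i e)]we -/W.
  by rewrite addr0 mulrA addrC expr2.
pose q := Num.sqrt (ip x x).
have xx0 : 0 < ip x x by rewrite xx ltr_pwDl// mulr_ge0// sqr_ge0.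
have q0 : 0 < q by rewrite sqrtr_gt0.
have q2 : q ^+ 2 = 1 + t ^+ 2 * W by rewrite sqr_sqrtr ?ip_ge0.
have : F (set_row i (q^-1 *: x) e) <= 1.
  apply: F_le1; rewrite (_ : _ *m _ = 1%:M) ?det1//.
  apply/matrixP => j k; rewrite gramE !row_set_row mxE.
  have [->|ji] := eqVneq j i; have [kE|ki] := eqVneq k i.
  - by rewrite ipZl ipZr -(@sqr_sqrtr _ (ip x x)) ?ip_ge0// -/q expr2 mulKf ?mulVf ?gt_eqF.
  - by rewrite ipZl xe eq_sym (negbTE ki) mulr0.
  - by rewrite ipZr ipC xe kE eq_sym (negbTE ji) mulr0.
  - by rewrite ee.
rewrite multilinearZ// mF set_row_id Fe -/c ler_pdivrMl// mulr1 => le_q.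
have tc : t * c = c ^+ 2 / D by rewrite /t mulrAC -expr2.
have tc0 : 0 <= t * c by rewrite tc divr_ge0 ?sqr_ge0// ltW.
have : (1 + t * c) ^+ 2 <= q ^+ 2.
  by rewrite lerXn2r// ?nnegrE ?addr_ge0// 1?addrC// ltW.
rewrite q2 => H.
have : 2 * (t * c) <= t ^+ 2 * W by have := sqr_ge0 (t * c); nra.
have tW : t ^+ 2 * W <= t * c.
  rewrite (_ : t ^+ 2 * W = t * c * (W / D)); last by rewrite /t; ring.
  by rewrite ler_piMr// ler_pdivrMr// mul1r /D -addrA lerDl addr_ge0 ?sqr_ge0.
move=> H2; have : t * c = 0 by lra.
rewrite tc => /eqP; rewrite mulf_eq0 invr_eq0 (gt_eqF D0) orbF sqrf_eq0.
by move/eqP.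
Qed.

(** The component of w normal to the plane contributes nothing by
    [first_cousin]; of its component in the plane, alternation only keeps the part
    along e_i. *)
Lemma comass_form_coord (e : 'M[R]_(p, n)) i w : e *m G *m e^T = 1%:M -> F e = 1 ->
  F (set_row i w e) = ip w (row i e).
Proof.
move=> oe Fe.
have ee j k : ip (row j e) (row k e) = (j == k)%:R by rewrite -gramE oe mxE.
pose z := \sum_j ip w (row j e) *: row j e.
have -> : w = (w - z) + z by rewrite subrK.
rewrite multilinearD// first_cousin// => [|j]; last first.
  rewrite -[w - z]addrC -scaleN1r ipDl ip_suml mulN1r.
  rewrite (bigD1 j)//= big1 => [|l lj]; last by rewrite ee (negbTE lj) mulr0.
  by rewrite ee eqxx mulr1 addr0 addNr.
rewrite add0r multilinear_sum// subrK (bigD1 i)//= set_row_id Fe mulr1.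
rewrite big1 ?addr0// => j ji; rewrite (aF (i := i) (j := j)) ?mulr0//.
  by rewrite eq_sym.
by rewrite !row_set_row eqxx; case: eqP.
Qed.

(** On a phi-plane the derivation form is the trace of the compression of L to
    the plane. *)
Lemma comass_trace (v : 'M[R]_(p, n)) : \det (v *m G *m v^T) = 1 -> F v = 1 ->
  exists2 e : 'M[R]_(p, n), e *m G *m e^T = 1%:M /\ F e = 1 &
    forall L : 'rV[R]_n -> 'rV[R]_n,
    (forall c u w, L (c *: u + w) = c *: L u + L w) ->
    derivation_form F L v = \sum_i ip (L (row i e)) (row i e).
Proof.
move=> dv Fv; have [e oe Fe] := Gram_Schmidt dv.
have Fe1 : F e = 1 by rewrite Fe.
exists e => // L lL.
rewrite -(Fe _ (derivation_form_multilinear lL mF) (derivation_form_alternating L mF aF)).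
by apply: eq_bigr => i _; rewrite comass_form_coord.
Qed.

End Comass.

End Gram.

Lemma cvg_mxP {R : realType} {T : Type} (F : set_system T) {FF : Filter F} {m n : nat}
    (A : T -> 'M[R]_(m, n)) (B : 'M[R]_(m, n)) :
  (forall i j, A t i j @[t --> F] --> B i j) -> A t @[t --> F] --> B.
Proof.
move=> AB P [Q QB QP]; rewrite /nbhs/=.
have : \forall t \near F, forall ij : 'I_m * 'I_n, Q ij.1 ij.2 (A t ij.1 ij.2).
  by apply: filter_forall => ij; exact: (AB ij.1 ij.2 _ (QB ij.1 ij.2)).
by apply: filterS => t Qt; apply: QP => i j; exact: (Qt (i, j)).
Qed.

Lemma cvg_coord {R : realType} {T : Type} (F : set_system T) {m n : nat}
    (A : T -> 'M[R]_(m, n)) (B : 'M[R]_(m, n)) i j :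
  A t @[t --> F] --> B -> A t i j @[t --> F] --> B i j.
Proof. by move=> AB; apply: (cvg_comp _ (fun M : 'M[R]_(m, n) => M i j) AB);
  exact: coord_continuous. Qed.

(** The coefficients of a form are smooth for fixed arguments only; this yields
    joint continuity, by induction on the number of rows and expansion of the
    first one in the standard basis. *)
Lemma multilinear_cvg {R : realType} {T : Type} (Phi : set_system T)
    {FPhi : Filter Phi} {p n : nat} (F : T -> 'M[R]_(p, n) -> R)
    (F0 : 'M[R]_(p, n) -> R) (v : T -> 'M[R]_(p, n)) (v0 : 'M[R]_(p, n)) :
  (\forall t \near Phi, multilinear (F t)) -> multilinear F0 ->
  (forall u, F t u @[t --> Phi] --> F0 u) ->
  v t @[t --> Phi] --> v0 -> F t (v t) @[t --> Phi] --> F0 v0.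
Proof.
elim: p F F0 v v0 => [|p IH] F F0 v v0 mF mF0 FF0 vv0.
  rewrite (_ : (fun t => _) = fun t => F t v0); first exact: FF0.
  by apply/funext => t; congr (F t _); apply/matrixP => -[].
(* [ins j u] puts the j-th basis vector on top of u, and [dr] drops the first row. *)
pose ins (j : 'I_n) (u : 'M[R]_(p, n)) : 'M[R]_(p.+1, n) :=
  \matrix_(k, l) if unlift ord0 k is Some k' then u k' l else (delta_mx 0 j : 'rV[R]_n) 0 l.
pose dr (u : 'M[R]_(p.+1, n)) : 'M[R]_(p, n) := \matrix_(k, l) u (lift ord0 k) l.
have insE u j : ins j (dr u) = set_row ord0 (delta_mx 0 j) u.
  apply/matrixP => k l; rewrite [LHS]mxE [RHS]mxE; case: unliftP => [k' ->|->].
    by rewrite mxE eq_sym (negbTE (neq_lift _ _)).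
  by rewrite eqxx.
have ins_set u j i w : ins j (set_row i w u) = set_row (lift ord0 i) w (ins j u).
  apply/matrixP => k l; rewrite !mxE; case: unliftP => [k' ->|->].
    by rewrite mxE (inj_eq lift_inj).
  by rewrite (negbTE (neq_lift _ _)).
have mins H j : multilinear H -> multilinear (fun u => H (ins j u)).
  by move=> mH u i c x y /=; rewrite !ins_set mH.
have FE H u : multilinear H -> H u = \sum_j u ord0 j * H (ins j (dr u)).
  move=> mH; under eq_bigr do rewrite insE.
  rewrite -multilinear_sum//; congr (H _); rewrite -[LHS](set_row_id ord0).
  congr set_row; rewrite [LHS]row_sum_delta; apply: eq_bigr => j _.
  by rewrite mxE.
rewrite (FE F0)//.
have : \sum_j v t ord0 j * F t (ins j (dr (v t))) @[t --> Phi] -->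
    \sum_j v0 ord0 j * F0 (ins j (dr v0)).
  apply: cvg_sumR => j _; apply: cvgM; first exact: cvg_coord vv0.
  apply: (IH (fun t u => F t (ins j u)) (fun u => F0 (ins j u)) (fun t => dr (v t))).
  - by apply: filterS mF => t; exact: mins.
  - exact: mins.
  - by move=> u; exact: FF0.
  - apply: cvg_mxP => k l; rewrite [X in _ --> X]mxE.
    under eq_fun do rewrite mxE; exact: cvg_coord vv0.
apply: cvg_trans; apply: near_eq_cvg; apply: filterS mF => t mFt.
by rewrite [RHS]FE.
Qed.

(** * The metric and the phi-Hessian in a chart *)

Lemma derive_coord {R : realType} {n m : nat} (V : 'rV[R]_n -> 'rV[R]_m) y t :
  (forall j, derivable (fun z => V z 0 j) y t) ->
  forall j, ('D_t V y) 0 j = 'D_t (fun z => V z 0 j) y.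
Proof. by move=> dV j; rewrite derive_row// mxE. Qed.

Lemma ipE {R : realType} {n : nat} (G : 'M[R]_n) (v w : 'rV[R]_n) :
  ip G v w = \sum_l \sum_k v 0 k * G k l * w 0 l.
Proof.
by rewrite /ip !mxE; apply: eq_bigr => l _; rewrite !mxE mulr_suml.
Qed.

Lemma derive_ip {R : realType} {n m : nat} (G : 'rV[R]_n -> 'M[R]_m)
    (V U : 'rV[R]_n -> 'rV[R]_m) y t :
  (forall k l, derivable (fun z => G z k l) y t) ->
  (forall j, derivable (fun z => V z 0 j) y t) ->
  (forall j, derivable (fun z => U z 0 j) y t) ->
  derivable (fun z => ip (G z) (V z) (U z)) y t /\
  'D_t (fun z => ip (G z) (V z) (U z)) y =
  'D_t (fun z => ip (G z) (V y) (U y)) y +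
  ip (G y) ('D_t V y) (U y) + ip (G y) (V y) ('D_t U y).
Proof.
move=> dG dV dU.
have d3 k l : derivable (fun z => V z 0 k * G z k l * U z 0 l) y t /\
  'D_t (fun z => V z 0 k * G z k l * U z 0 l) y =
  V y 0 k * 'D_t (fun z => G z k l) y * U y 0 l +
  ('D_t V y) 0 k * G y k l * U y 0 l + V y 0 k * G y k l * ('D_t U y) 0 l.
  have [d1 E1] := derivable_mulE (dV k) (dG k l).
  have [d2 E2] := derivable_mulE d1 (dU l).
  split; first exact: d2.
  rewrite E2 E1 !derive_coord//; ring.
have d3c k l : derivable (fun z => V y 0 k * G z k l * U y 0 l) y t /\
  'D_t (fun z => V y 0 k * G z k l * U y 0 l) y =
  V y 0 k * 'D_t (fun z => G z k l) y * U y 0 l.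
  have [c1 Ec1] := derivable_cstE (V y 0 k) y t.
  have [c2 Ec2] := derivable_cstE (U y 0 l) y t.
  have [d1 E1] := derivable_mulE c1 (dG k l).
  have [d2 E2] := derivable_mulE d1 c2.
  split; first exact: d2.
  rewrite E2 E1 Ec1 Ec2; ring.
under eq_fun do rewrite ipE; under [X in _ = 'D_t X y + _ + _]eq_fun do rewrite ipE.
have S (f : 'I_m -> 'I_m -> 'rV[R]_n -> R) : (forall k l, derivable (f k l) y t) ->
    derivable (fun z => \sum_l \sum_k f k l z) y t /\
    'D_t (fun z => \sum_l \sum_k f k l z) y = \sum_l \sum_k 'D_t (f k l) y.
  move=> df.
  have Sl l : derivable (fun z => \sum_k f k l z) y t /\
     'D_t (fun z => \sum_k f k l z) y = \sum_k 'D_t (f k l) y.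
    by apply: derivable_sumE => k _; exact: df.
  have [d E] := @derivable_sumE _ _ _ (index_enum 'I_m) predT
     (fun l z => \sum_k f k l z) y t (fun l _ => (Sl l).1).
  by split; [exact: d|rewrite E; apply: eq_bigr => l _; rewrite (Sl l).2].
have [d E] := S (fun k l z => V z 0 k * G z k l * U z 0 l) (fun k l => (d3 k l).1).
have [d' E'] := S (fun k l z => V y 0 k * G z k l * U y 0 l) (fun k l => (d3c k l).1).
split; first exact: d.
rewrite E E' !ipE -!big_split/=; apply: eq_bigr => l _.
rewrite -!big_split/=; apply: eq_bigr => k _.
by rewrite (d3 k l).2 (d3c k l).2.
Qed.

Section Chart.
Context {R : realType} {n : nat} {X : topologicalType} {M : manifold R n X}.
Implicit Types (a b : chart_index M) (W : set X) (f : X -> R).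
Implicit Types (y v w u : 'rV[R]_n).

Lemma chart_range_open a : open (chart_range a).
Proof. exact: chart_open. Qed.

Lemma chart_image_open a W : open W -> open (chart a @` (dom a `&` W)).
Proof.
move=> oW; rewrite openE => _ [x [ax Wx] <-].
have ra : (chart a @` dom a) (chart a x) by exists x.
have cV := chartV_continuous ra.
have nW : nbhs (chartV a (chart a x)) W.
  by rewrite chartK//; apply: open_nbhs_nbhs; split.
have H := filterI (open_near (@chart_range_open a) ra) (cV _ nW).
apply: filterS (H _) => z [[x' ax' <-]] /=; rewrite chartK// => Wx'.
by exists x'.
Qed.

Lemma chart_image_sub a W : chart a @` (dom a `&` W) `<=` chart_range a.
Proof. by move=> _ [x [ax _] <-]; exists x. Qed.

Lemma chart_rangeP a y : chart_range a y -> dom a (chartV a y) /\ chart a (chartV a y) = y.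
Proof. by move=> [x ax <-]; rewrite chartK. Qed.

Variable g : riemannian_metric M.
Local Notation gm a := (metric_mx g a).

Lemma metric_definite a y : chart_range a y ->
  forall v, v != 0 -> 0 < (v *m gm a y *m v^T) 0 0.
Proof. by move=> ay v; exact: metric_pos. Qed.

Lemma metric_unit a y : chart_range a y -> gm a y \in unitmx.
Proof.
move=> ay; rewrite -row_free_unit -kermx_eq0; apply/rowV0P => v /sub_kermxP vG.
apply: contraTeq isT => v0.
by have := metric_pos g ay v0; rewrite vG mul0mx mxE ltxx.
Qed.

Lemma ip_inj a y v w : chart_range a y ->
  (forall u, ip (gm a y) v u = ip (gm a y) w u) -> v = w.
Proof.
move=> ay E; have : v *m gm a y = w *m gm a y.
  apply/rowP => j; have := E (delta_mx 0 j).
  by rewrite /ip !trmx_delta -!colE !mxE.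
by move/(congr1 (mulmxr (invmx (gm a y)))); rewrite /= !mulmxK ?metric_unit.
Qed.

(** Cramer's rule. *)
Lemma smooth_invmx a i j : smooth_on (chart_range a) (fun z => invmx (gm a z) i j).
Proof.
have oD := @chart_range_open a.
apply: (smooth_on_ext (f := fun z => (\det (gm a z))^-1 * cofactor (gm a z) j i)) => //.
  by move=> z az; rewrite /invmx metric_unit// !mxE.
have sdet := smooth_det oD (metric_smooth g a).
apply: smooth_mul => //.
  apply: smooth_inv => // z az; have := metric_unit az.
  by rewrite unitmxE unitfE.
apply: smooth_mul => //; first exact: smooth_cst.
apply: smooth_det => // k l; under eq_fun do rewrite !mxE.
exact: metric_smooth.
Qed.

Lemma smooth_ip a v w : smooth_on (chart_range a) (fun z => ip (gm a z) v w).
Proof.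
have oD := @chart_range_open a; under eq_fun do rewrite ipE.
apply: smooth_sum => // l _; apply: smooth_sum => // k _.
apply: smooth_mul => //; last exact: smooth_cst.
by apply: smooth_mul => //; [exact: smooth_cst|exact: metric_smooth].
Qed.

Lemma derivable_metric a y t k l : chart_range a y -> derivable (fun z => gm a z k l) y t.
Proof.
by move=> ay; apply: smooth_derivable ay; [exact: chart_range_open|exact: metric_smooth].
Qed.

Definition dmetric a y t v w : R := 'D_t (fun z => ip (gm a z) v w) y.

Lemma dmetricDt a y c t s v w : chart_range a y ->
  dmetric a y (c *: t + s) v w = c * dmetric a y t v w + dmetric a y s v w.
Proof.
by move=> ay; apply: derive_linear (smooth_ip _ _ _) ay _ _ _; exact: chart_range_open.
Qed.

Lemma dmetricDl a y c t u v w : chart_range a y ->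
  dmetric a y t (c *: u + v) w = c * dmetric a y t u w + dmetric a y t v w.
Proof.
move=> ay; have d z := smooth_derivable t (@chart_range_open a) (smooth_ip a z w) ay.
have [c1 E1] := derivable_mulE (derivable_cstE c y t).1 (d u).
have [c2 E2] := derivable_addE c1 (d v).
rewrite /dmetric; under [X in 'D_t X y = _]eq_fun do rewrite ipDl.
by rewrite E2 E1 (derivable_cstE _ _ _).2 mulr0 addr0.
Qed.

Lemma dmetricC a y t v w : chart_range a y -> dmetric a y t v w = dmetric a y t w v.
Proof.
move=> ay; apply: near_eq_derive.
apply: filterS (open_near (@chart_range_open a) ay) => z az.
by rewrite (ipC (Defs.metric_sym g az)).
Qed.

Lemma dmetricDr a y c t u v w : chart_range a y ->
  dmetric a y t w (c *: u + v) = c * dmetric a y t w u + dmetric a y t w v.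
Proof. by move=> ay; rewrite dmetricC// dmetricDl// !(dmetricC _ w). Qed.

Lemma dmetricZt a y c t v w : chart_range a y ->
  dmetric a y (c *: t) v w = c * dmetric a y t v w.
Proof. by move=> ay; have := dmetricDt c t 0 v w ay; rewrite addr0 /dmetric derive0 addr0. Qed.

Lemma dmetricZl a y c t v w : chart_range a y ->
  dmetric a y t (c *: v) w = c * dmetric a y t v w.
Proof.
move=> ay; have := dmetricDl c t v 0 w ay; rewrite addr0 => ->.
rewrite [X in _ + X](_ : _ = 0) ?addr0//.
by rewrite /dmetric; under eq_fun do rewrite ip0l; rewrite derive_cst.
Qed.

Lemma dmetricZr a y c t v w : chart_range a y ->
  dmetric a y t w (c *: v) = c * dmetric a y t w v.
Proof. by move=> ay; rewrite dmetricC// dmetricZl// dmetricC. Qed.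

(** Koszul's formula, extended from the basis vectors to an arbitrary vector u. *)
Lemma christoffelE a y v w u : chart_range a y ->
  ip (gm a y) (christoffel g a y v w) u =
  2^-1 * (dmetric a y v w u + dmetric a y w v u - dmetric a y u v w).
Proof.
move=> ay; rewrite /ip /christoffel mulmxKV ?metric_unit// mxE.
have Dt t z : dmetric a y t z u = \sum_l u 0 l * dmetric a y t z (basis_vector l).
  by apply: (linear_form_sum (K := dmetric a y t z)) => c x x'; exact: dmetricDr.
have Du z t : dmetric a y u z t = \sum_l u 0 l * dmetric a y (basis_vector l) z t.
  by apply: (linear_form_sum (K := fun u => dmetric a y u z t)) => c x x'; exact: dmetricDt.
rewrite (Dt v) (Dt w) (Du v) -big_split/= -sumrB mulr_sumr.
apply: eq_bigr => l _; rewrite !mxE /dmetric /inner /ip; ring.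
Qed.

End Chart.

Arguments metric_definite {R n X M} g {a y} ay v.

Section Gradient.
Context {R : realType} {n : nat} {X : topologicalType} {M : manifold R n X}.
Variable g : riemannian_metric M.
Local Notation gm a := (metric_mx g a).
Variables (f : X -> R) (a : chart_index M) (E : set 'rV[R]_n).
Hypothesis oE : open E.
Hypothesis Ea : E `<=` chart_range a.
Local Notation F := (f \o chartV a).
Hypothesis sF : smooth_on E F.
Implicit Types (y v w u : 'rV[R]_n).

Lemma gradientE y w : E y -> ip (gm a y) (gradient g f a y) w = 'D_w F y.
Proof.
move=> Ey; rewrite /ip /gradient mulmxKV ?metric_unit//; last exact: Ea.
rewrite (smooth_diff oE sF Ey).2 mxE; apply: eq_bigr => i _.
by rewrite !mxE mulrC.
Qed.

Lemma smooth_gradient j : smooth_on E (fun z => gradient g f a z 0 j).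
Proof.
rewrite /gradient; under eq_fun do rewrite mxE.
apply: smooth_sum => // k _; apply: smooth_mul => //.
  under eq_fun do rewrite mxE; exact: smooth_partial.
by apply: (smooth_on_sub Ea); exact: smooth_invmx.
Qed.

Definition hess y v u : R := ip (gm a y) (levi_civita g a y v (gradient g f a)) u.

(** The coordinate formula D_v D_u f - df(Gamma(v, u)), since df(w) = <G, w> and
    by Koszul's formula.  The derivative of the gradient field has been eliminated: only
    second derivatives of f remain, and first derivatives of the metric contracted
    with the value G of the gradient at y.  Comparing charts, compositions and
    defining functions then becomes algebra. *)
Lemma hessE y v u : E y -> let G := gradient g f a y in
  hess y v u = 'D_v ('D_u F) y
   - 2^-1 * (dmetric g a y v G u + dmetric g a y u v G - dmetric g a y G v u).
Proof.
move=> Ey G; have ay := Ea Ey.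
rewrite /hess /levi_civita -['D_v _ _]scale1r ipDl mul1r christoffelE// -/G.
have dZ j : derivable (fun z => gradient g f a z 0 j) y v.
  by apply: smooth_derivable Ey => //; exact: smooth_gradient.
have dG k l : derivable (fun z => gm a z k l) y v by exact: derivable_metric.
have [_] := @derive_ip _ _ _ (fun z => gm a z) (gradient g f a) (fun=> u) y v
  dG dZ (fun j => derivable_cst _ _ _).
have -> : 'D_v (fun=> u) y = 0 by exact: derive_cst.
rewrite [ip _ _ 0]/ip trmx0 mulmx0 mxE addr0.
have -> : 'D_v (fun z => ip (gm a z) (gradient g f a z) u) y = 'D_v ('D_u F) y.
  by apply: near_eq_derive; apply: filterS (open_near oE Ey) => z; exact: gradientE.
rewrite -/G -/(dmetric g a y v G u) => ->; lra.
Qed.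

Lemma levi_civita_linear y : E y -> forall (c : R) v w,
  levi_civita g a y (c *: v + w) (gradient g f a) =
  c *: levi_civita g a y v (gradient g f a) + levi_civita g a y w (gradient g f a).
Proof.
move=> Ey c v w; apply: (@ip_inj _ _ _ _ g a y); first exact: Ea.
move=> u; rewrite ipDl; have ay := Ea Ey.
change (hess y (c *: v + w) u = c * hess y v u + hess y w u).
rewrite (hessE (c *: v + w) u Ey) (hessE v u Ey) (hessE w u Ey).
rewrite (derive_linear oE (smooth_derive u oE sF) Ey) !dmetricDt// !dmetricDl//.
move: ('D_v ('D_u F) y) ('D_w ('D_u F) y) => dv dw.
move: (gradient g f a y) => G.
move: (dmetric g a y v G u) (dmetric g a y w G u) (dmetric g a y u v G).
move: (dmetric g a y u w G) (dmetric g a y G v u) (dmetric g a y G w u) => *.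
by ring.
Qed.

End Gradient.

(** * Composition with a function of one variable *)

Section ChainRule.
Context {R : realType} {n : nat} {X : topologicalType} {M : manifold R n X}.
Variable g : riemannian_metric M.
Local Notation gm a := (metric_mx g a).
Variables (f : X -> R) (a : chart_index M) (E : set 'rV[R]_n).
Hypothesis oE : open E.
Hypothesis Ea : E `<=` chart_range a.
Local Notation F := (f \o chartV a).
Hypothesis sF : smooth_on E F.
Variables (h h1 h2 : R -> R).
Hypothesis dh : forall z, E z -> is_derive (F z) 1 h (h1 (F z)).
Hypothesis dh1 : forall z, E z -> is_derive (F z) 1 h1 (h2 (F z)).
Hypothesis shF : smooth_on E ((h \o f) \o chartV a).
Implicit Types (y v w u : 'rV[R]_n).

Lemma derive_post y w : E y -> 'D_w ((h \o f) \o chartV a) y = h1 (F y) * 'D_w F y.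
Proof. by move=> Ey; exact: (derive_comp1 (smooth_derivable w oE sF Ey) (dh Ey)).2. Qed.

Lemma gradient_post y : E y -> gradient g (h \o f) a y = h1 (F y) *: gradient g f a y.
Proof.
move=> Ey; apply: (@ip_inj _ _ _ _ g a y); first exact: Ea.
move=> u; rewrite ipZl (gradientE g oE Ea shF u Ey) (gradientE g oE Ea sF u Ey).
exact: derive_post.
Qed.

Lemma hess_post y v u : E y ->
  hess g (h \o f) a y v u =
  h1 (F y) * hess g f a y v u + h2 (F y) * 'D_v F y * 'D_u F y.
Proof.
move=> Ey; have ay := Ea Ey.
rewrite (hessE g oE Ea shF v u Ey) (hessE g oE Ea sF v u Ey) gradient_post//.
have -> : 'D_v ('D_u ((h \o f) \o chartV a)) y =
    h1 (F y) * 'D_v ('D_u F) y + h2 (F y) * 'D_v F y * 'D_u F y.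
  transitivity ('D_v (fun z => h1 (F z) * 'D_u F z) y).
    by apply: near_eq_derive; apply: filterS (open_near oE Ey) => z; exact: derive_post.
  have [d1 E1] := derive_comp1 (smooth_derivable v oE sF Ey) (dh1 Ey).
  have [d2 E2] := derivable_mulE d1 (smooth_derivable v oE (smooth_derive u oE sF) Ey).
  rewrite E2 E1; move: ('D_v ('D_u F) y) ('D_v F y) ('D_u F y) => A B C.
  by ring.
move: (gradient g f a y) => G.
rewrite dmetricZl// dmetricZr// dmetricZt//.
move: ('D_v ('D_u F) y) ('D_v F y) ('D_u F y) (dmetric g a y v G u) (dmetric g a y u v G)
  (dmetric g a y G v u) (h1 (F y)) (h2 (F y)) => *.
by ring.
Qed.

Lemma levi_civita_post y v : E y ->
  levi_civita g a y v (gradient g (h \o f) a) =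
  h1 (F y) *: levi_civita g a y v (gradient g f a) +
  h2 (F y) * 'D_v F y *: gradient g f a y.
Proof.
move=> Ey; apply: (@ip_inj _ _ _ _ g a y); first exact: Ea.
move=> u; rewrite ipDl ipZl (gradientE g oE Ea sF u Ey).
exact: hess_post.
Qed.

(** By [levi_civita_post], nabla_v (grad (h o f)) is
    h'(f) nabla_v (grad f) + h''(f) (v f) grad f; insert it in each slot of phi. *)
Lemma phi_hessian_post p (phi : smooth_form M p) y (v : 'M[R]_(p, n)) : E y ->
  phi_hessian g phi (h \o f) a y v =
  h1 (F y) * phi_hessian g phi f a y v + h2 (F y) *
    derivation_form (phi a y) (fun w => 'D_w F y *: gradient g f a y) v.
Proof.
move=> Ey; have ml : multilinear (phi a y).
  by move=> w i c u x; apply: form_linear; exact: Ea.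
rewrite /phi_hessian /derivation_form !mulr_sumr -big_split/=.
apply: eq_bigr => i _; rewrite levi_civita_post// ml; congr (_ + _).
by rewrite -scalerA multilinearZ.
Qed.

End ChainRule.

(** * Independence of the chart *)

Section ChangeOfChart.
Context {R : realType} {n : nat} {X : topologicalType} {M : manifold R n X}.
Variable g : riemannian_metric M.
Local Notation gm a := (metric_mx g a).
Variables (a b : chart_index M) (f : X -> R) (W : set X).
Hypothesis oW : open W.
Hypothesis sf : smooth_fun M W f.
Implicit Types (y v w u t : 'rV[R]_n).

(** Suffixes a and b refer to the two charts; tau is the transition map, and
    [V v] is the constant field v of the chart a read in the chart b. *)
Let tau (z : 'rV[R]_n) : 'rV[R]_n := chart b (chartV a z).
Let E : set 'rV[R]_n := chart a @` (dom a `&` (dom b `&` W)).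
Let Eb : set 'rV[R]_n := chart b @` (dom b `&` W).
Local Notation Fa := (f \o chartV a).
Local Notation Fb := (f \o chartV b).

Let oE : open E.
Proof. by apply: chart_image_open; apply: openI => //; exact: dom_open. Qed.

Let oEb : open Eb.
Proof. exact: chart_image_open. Qed.

Let Ea : E `<=` chart_range a.
Proof. exact: chart_image_sub. Qed.

Let Ebb : Eb `<=` chart_range b.
Proof. exact: chart_image_sub. Qed.

Let tauE z : E z -> [/\ dom a (chartV a z), dom b (chartV a z), chart a
  (chartV a z) = z & Eb (tau z)].
Proof.
move=> [x [ax [bx Wx]] <-]; rewrite /tau chartK//; split => //; by exists x.
Qed.

Let sFa : smooth_on E Fa.
Proof.
apply: smooth_on_sub (sf a); apply: image_subset => x [? [? ?]]; by split.
Qed.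

Let sFb : smooth_on Eb Fb. Proof. exact: sf. Qed.

Let stau j : smooth_on E (fun z => tau z 0 j).
Proof.
apply: smooth_on_sub (@transition_smooth _ _ _ M a b j).
by apply: image_subset => x [? [? ?]].
Qed.

Let dtau z : E z -> differentiable tau z.
Proof.
by move=> Ez; apply: differentiable_row => j; exact: (smooth_diff oE (stau j) Ez).1.
Qed.

Local Notation V v := (fun z => 'D_v tau z).

Let VE v z j : E z -> (V v z) 0 j = 'D_v (fun z => tau z 0 j) z.
Proof.
move=> Ez; apply: derive_coord => k.
exact: smooth_derivable (stau k) Ez.
Qed.

Let sV v j : smooth_on E (fun z => V v z 0 j).
Proof.
by apply: (smooth_on_ext (f := 'D_v (fun z => tau z 0 j))) => // [z Ez|];
  [rewrite VE|exact: smooth_derive].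
Qed.

Let VJ z v : E z -> V v z = v *m transition_jacobian a b z.
Proof. by move=> Ez; exact: deriveEjacobian (dtau Ez). Qed.

Let metric_pull z v w : E z -> ip (gm a z) v w = ip (gm b (tau z)) (V v z) (V w z).
Proof.
move=> Ez; have [az bz zE _] := tauE Ez; rewrite !VJ//.
have := metric_change g az bz; rewrite zE /= => ->.
by rewrite /ip trmx_mul !mulmxA.
Qed.

(** The second derivative of the transition map. *)
Let Q v w z : 'rV[R]_n := 'D_v (V w) z.

Let dV v w z j : E z -> derivable (fun z => V w z 0 j) z v.
Proof. by move=> Ez; exact: smooth_derivable (sV w j) Ez. Qed.

Let QE v w z j : E z -> Q v w z 0 j = 'D_v ('D_w (fun z => tau z 0 j)) z.
Proof.
move=> Ez; transitivity ('D_v (fun z => V w z 0 j) z).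
  exact: (@derive_coord R n n (fun z => 'D_w tau z) z v (fun k => @dV v w z k Ez)).
by apply: near_eq_derive; apply: filterS (open_near oE Ez) => x Ex; exact: VE.
Qed.

Let QC v w z : E z -> Q v w z = Q w v z.
Proof.
move=> Ez; apply/rowP => j; apply: (etrans (@QE v w z j Ez)).
apply: (etrans _ (esym (@QE w v z j Ez))); exact: derive_comm oE (stau j) Ez.
Qed.

Let pull_differentiable (H : 'rV[R]_n -> R) (D : set 'rV[R]_n) z v : open D -> smooth_on D H ->
  D (tau z) -> E z ->
  derivable (fun z => H (tau z)) z v /\
  'D_v (fun z => H (tau z)) z = 'D_(V v z) H (tau z).
Proof.
move=> oD sH Dz Ez; have [d Ed] := @chain_rule R _ _ _ tau H z v (dtau Ez)
  (smooth_diff oD sH Dz).1.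
by split; [exact: diff_derivable|exact: Ed].
Qed.

(** Differentiate [metric_pull] by the Leibniz rule. *)
Let dmetric_pull z t v w : E z -> dmetric g a z t v w =
  dmetric g b (tau z) (V t z) (V v z) (V w z) +
  ip (gm b (tau z)) (Q t v z) (V w z) + ip (gm b (tau z)) (V v z) (Q t w z).
Proof.
move=> Ez; have [_ _ _ Ebz] := tauE Ez; have bz := Ebb Ebz.
have oD := @chart_range_open _ _ _ M b.
have dG k l : derivable (fun z => gm b (tau z) k l) z t.
  exact: (@pull_differentiable (fun y => gm b y k l) _ z t oD
    (@metric_smooth _ _ _ _ g b k l) bz Ez).1.
have [_ D] := derive_ip dG (fun j => @dV t v z j Ez) (fun j => @dV t w z j Ez).
transitivity ('D_t (fun z => ip (gm b (tau z)) (V v z) (V w z)) z).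
  by apply: near_eq_derive; apply: filterS (open_near oE Ez) => x; exact: metric_pull.
apply: (etrans D); apply: (f_equal2 +%R _ erefl); apply: (f_equal2 +%R _ erefl).
exact: (@pull_differentiable _ _ z t oD (smooth_ip g b (V v z) (V w z)) bz Ez).2.
Qed.

Let deriv_pull z w : E z -> 'D_w Fa z = 'D_(V w z) Fb (tau z).
Proof.
move=> Ez; have [_ _ _ Ebz] := tauE Ez.
rewrite -(@pull_differentiable _ _ z w oEb sFb Ebz Ez).2.
apply: near_eq_derive; apply: filterS (open_near oE Ez) => x Ex /=.
by have [? ? _ _] := tauE Ex; rewrite /tau chartK.
Qed.

Let deriv2_pull z v w : E z -> 'D_v ('D_w Fa) z =
  'D_(Q v w z) Fb (tau z) + 'D_(V v z) ('D_(V w z) Fb) (tau z).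
Proof.
move=> Ez; have [_ _ _ Ebz] := tauE Ez.
have P k : derivable (fun z => 'D_(basis_vector k) Fb (tau z)) z v /\
   'D_v (fun z => 'D_(basis_vector k) Fb (tau z)) z =
   'D_(V v z) ('D_(basis_vector k) Fb) (tau z).
  exact: (@pull_differentiable _ _ z v oEb (smooth_partial k sFb) Ebz Ez).
transitivity ('D_v (fun z => \sum_k V w z 0 k * 'D_(basis_vector k) Fb (tau z)) z).
  apply: near_eq_derive; apply: filterS (open_near oE Ez) => x Ex.
  have [_ _ _ Ebx] := tauE Ex.
  by rewrite deriv_pull// (smooth_diff oEb sFb Ebx).2.
have [_ ->] := @derivable_sumE _ _ _ (index_enum 'I_n) predT
  (fun k z => V w z 0 k * 'D_(basis_vector k) Fb (tau z)) z v
  (fun k _ => (derivable_mulE (@dV v w z k Ez) (P k).1).1).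
have -> : 'D_(V v z) ('D_(V w z) Fb) (tau z) =
    \sum_k V w z 0 k * 'D_(V v z) ('D_(basis_vector k) Fb) (tau z).
  have dp k : derivable ('D_(basis_vector k) Fb) (tau z) (V v z).
    by apply: smooth_derivable Ebz => //; exact: smooth_partial.
  transitivity ('D_(V v z) (fun y => \sum_k V w z 0 k * 'D_(basis_vector k) Fb y) (tau z)).
    apply: near_eq_derive; apply: filterS (open_near oEb Ebz) => x Ex.
    exact: (smooth_diff oEb sFb Ex).2.
  have dk k := derivable_mulE (derivable_cstE (V w z 0 k) (tau z) (V v z)).1 (dp k).
  have [_ ->] := @derivable_sumE _ _ _ (index_enum 'I_n) predT
    (fun k y => V w z 0 k * 'D_(basis_vector k) Fb y) (tau z) (V v z) (fun k _ => (dk k).1).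
  apply: eq_bigr => k _; rewrite (dk k).2 (derivable_cstE _ _ _).2 mulr0 addr0.
  by [].
rewrite (smooth_diff oEb sFb Ebz).2 -big_split/=; apply: eq_bigr => k _.
rewrite (derivable_mulE (@dV v w z k Ez) (P k).1).2 (P k).2 addrC; congr (_ + _).
rewrite mulrC; congr (_ * _).
apply/esym; exact: (@derive_coord R n n (fun z => 'D_w tau z) z v (fun k => @dV v w z k Ez)).
Qed.

Let unitJ z : E z -> transition_jacobian a b z \in unitmx.
Proof.
move=> Ez; have [az bz zE _] := tauE Ez.
have := metric_unit g (Ea Ez); have := metric_change g az bz; rewrite zE /= => ->.
by rewrite -mulmxA unitmx_mul => /andP[].
Qed.

Let ip_inj_pull z v w : E z ->
  (forall u, ip (gm b (tau z)) v (V u z) = ip (gm b (tau z)) w (V u z)) -> v = w.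
Proof.
move=> Ez H; have [_ _ _ Ebz] := tauE Ez.
apply: (ip_inj (g := g) (Ebb Ebz)) => u.
have := H (u *m invmx (transition_jacobian a b z)).
by rewrite VJ// mulmxKV// unitJ.
Qed.

Let gradient_pull z : E z -> V (gradient g f a z) z = gradient g f b (tau z).
Proof.
move=> Ez; have [_ _ _ Ebz] := tauE Ez; apply: (ip_inj_pull Ez) => u.
rewrite -metric_pull// (gradientE g oE Ea sFa u Ez).
by rewrite (gradientE g oEb Ebb sFb _ Ebz) deriv_pull.
Qed.

(** The inhomogeneous terms cancel: three derivatives of the metric contribute
    six terms in Q, of which four cancel by the symmetry of Q and two match the
    term D_(Q v u) f coming from the second derivative of f. *)
Let hess_pull z v u : E z ->
  hess g f a z v u = hess g f b (tau z) (V v z) (V u z).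
Proof.
move=> Ez; have [_ _ _ Ebz] := tauE Ez.
rewrite (hessE g oE Ea sFa v u Ez) (hessE g oEb Ebb sFb _ _ Ebz) -gradient_pull//.
rewrite deriv2_pull// !dmetric_pull//.
rewrite -(gradientE g oEb Ebb sFb _ Ebz) -gradient_pull//.
set G := gradient g f a z.
have sym := Defs.metric_sym g (Ebb Ebz).
rewrite (QC u v Ez) (QC G v Ez) (QC G u Ez).
move: (Q v u z) (Q v G z) (Q u G z) => q1 q2 q3.
move: ('D_v tau z) ('D_u tau z) ('D_G tau z) => v' u' G'.
rewrite (ipC sym q1).
move: (dmetric g b (tau z) v' G' u') (dmetric g b (tau z) u' v' G')
  (dmetric g b (tau z) G' v' u') => d1 d2 d3.
move: ('D_v' ('D_u' Fb) (tau z)) => d4.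
move: (ip (gm b (tau z)) G' q1) (ip (gm b (tau z)) q2 u') (ip (gm b
  (tau z)) v' q3) => i1 i2 i3.
by field.
Qed.

Let levi_civita_pull z v : E z ->
  V (levi_civita g a z v (gradient g f a)) z =
  levi_civita g b (tau z) (V v z) (gradient g f b).
Proof.
move=> Ez; apply: (ip_inj_pull Ez) => u.
by rewrite -metric_pull//; exact: hess_pull.
Qed.

Section Form.
Context {p : nat} (phi : smooth_form M p).
Variable x : X.
Hypotheses (ax : dom a x) (bx : dom b x) (Wx : W x).
Let J := transition_jacobian a b (chart a x).

Let Ex : E (chart a x). Proof. by exists x. Qed.

Let taux : tau (chart a x) = chart b x. Proof. by rewrite /tau chartK. Qed.

Lemma phi_hessian_change (v : 'M[R]_(p, n)) :
  phi_hessian g phi f a (chart a x) v = phi_hessian g phi f b (chart b x) (v *m J).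
Proof.
apply: eq_bigr => i _; rewrite (form_change phi _ ax bx) mul_set_row -/J.
congr (phi b _ (set_row i _ _)).
have E2 : 'D_(row i v) tau (chart a x) = row i (v *m J).
  by rewrite row_mul; exact: (@VJ (chart a x) _ Ex).
apply: (etrans (esym (@VJ (chart a x) _ Ex))).
apply: (etrans (@levi_civita_pull (chart a x) _ Ex)).
by rewrite taux E2.
Qed.

Lemma phi_plane_change (v : 'M[R]_(p, n)) :
  phi_plane g phi a (chart a x) v -> phi_plane g phi b (chart b x) (v *m J).
Proof.
move=> [uv pv]; split; last by rewrite -(form_change phi v ax bx).
rewrite /unit_simple in uv *; rewrite -[RHS]uv; congr (\det _).
rewrite (metric_change g ax bx) -/J.
by rewrite trmx_mul !mulmxA.
Qed.

End Form.

End ChangeOfChart.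

(** The phi-Hessian and the phi-planes transform in the same way, so positivity
    in one chart around x gives positivity in all of them. *)
Lemma strictly_psh_chart {R : realType} {n p : nat} {X : topologicalType}
    {M : manifold R n X} (g : riemannian_metric M) (phi : smooth_form M p)
    (a : chart_index M) (f : X -> R) (W : set X) (x : X) :
  open W -> smooth_fun M W f -> W x -> dom a x ->
  (forall v : 'M[R]_(p, n), phi_plane g phi a (chart a x) v ->
    0 < phi_hessian g phi f a (chart a x) v) ->
  strictly_psh_at g phi f x.
Proof.
move=> oW sf Wx ax H b v bx pv.
rewrite (phi_hessian_change g oW sf phi bx ax Wx); apply: H.
exact: phi_plane_change.
Qed.

(** * The estimate near a boundary point *)

Lemma linear_cvg {R : realType} {n : nat} {T : Type} (Phi : set_system T) {FPhi : Filter Phi}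
    (L : T -> 'rV[R]_n -> R) (L0 : 'rV[R]_n -> R) (v : T -> 'rV[R]_n) (v0 : 'rV[R]_n) :
  (\forall t \near Phi, forall c u w, L t (c *: u + w) = c * L t u + L t w) ->
  (forall c u w, L0 (c *: u + w) = c * L0 u + L0 w) ->
  (forall u, L t u @[t --> Phi] --> L0 u) ->
  v t @[t --> Phi] --> v0 -> L t (v t) @[t --> Phi] --> L0 v0.
Proof.
move=> lL lL0 LL0 vv0.
rewrite (linear_form_sum v0 lL0).
have : \sum_j v t 0 j * L t (delta_mx 0 j) @[t --> Phi] --> \sum_j v0 0 j * L0 (delta_mx 0 j).
  by apply: cvg_sumR => j _; apply: cvgM => //; exact: cvg_coord vv0.
apply: cvg_trans; apply: near_eq_cvg; apply: filterS lL => t lLt.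
by rewrite [RHS](linear_form_sum _ lLt).
Qed.

Lemma cvg_near_neq {R : realType} {T : Type} (Phi : set_system T) {FPhi : Filter Phi}
    (h : T -> R) (l c : R) : h t @[t --> Phi] --> l -> l != c -> \forall t \near Phi, h t != c.
Proof.
move=> hl lc; have d0 : 0 < `|l - c| by rewrite normr_gt0 subr_eq0.
have /cvgrPdist_lt/(_ _ d0) := hl; apply: filterS => t.
by apply: contraTneq => ->; rewrite ltxx.
Qed.

Lemma cvg_near_gt0 {R : realType} {T : Type} (Phi : set_system T) {FPhi : Filter Phi}
    (h : T -> R) (l : R) : h t @[t --> Phi] --> l -> 0 < l -> \forall t \near Phi, 0 < h t.
Proof.
move=> hl l0; have /cvgrPdist_lt/(_ _ l0) := hl; apply: filterS => t.
by rewrite ltr_norml => /andP[_]; lra.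
Qed.

(** Cauchy-Schwarz against a unit vector. *)
Lemma ip_cauchy {R : realType} {n : nat} (G : 'M[R]_n) (v w : 'rV[R]_n) :
  G^T = G -> (forall v : 'rV[R]_n, v != 0 -> 0 < (v *m G *m v^T) 0 0) ->
  ip G v v = 1 -> ip G w v ^+ 2 <= ip G w w.
Proof.
move=> sG pG vv; have := ip_ge0 pG (- ip G w v *: v + w).
rewrite ipDl !(ipDr sG) vv (ipC sG v w); move: (ip G w v) (ip G w w) => b c.
by rewrite expr2; lra.
Qed.

Lemma box_compact {R : realType} {p n : nat} (C : R) :
  compact [set e : 'M[R]_(p, n) | forall i j, `|e i j| <= C].
Proof.
pose A := [set v : 'rV[R]_(p * n) | forall k, `[- C, C]%classic (v ord0 k)].
have cA : compact A by apply: (@rV_compact _ _ (fun=> `[- C, C]%classic)) => k;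
  exact: segment_compact.
have -> : [set e : 'M[R]_(p, n) | forall i j, `|e i j| <= C] = vec_mx @` A.
  apply/seteqP; split => [e eC|_ [v vA <-] i j].
    exists (mxvec e); last by rewrite mxvecK.
    move=> k; case/mxvec_indexP: k => i j; rewrite mxvecE /=.
    by rewrite in_itv/= -ler_norml.
  by rewrite mxE ler_norml; have := vA (mxvec_index i j); rewrite /= in_itv.
have cV : continuous (fun v : 'rV[R]_(p * n) => vec_mx v : 'M[R]_(p, n)).
  move=> v; apply: (@cvg_mxP _ _ (nbhs v)) => i j; rewrite mxE.
  under eq_fun do rewrite mxE; exact: coord_continuous.
by apply: continuous_compact => //; exact: continuous_subspaceT.
Qed.

Section LocalEstimate.
Context {R : realType} {n p : nat} {X : topologicalType} {M : manifold R n X}.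
Variable g : riemannian_metric M.
Local Notation gm a := (metric_mx g a).
Variables (f : X -> R) (a : chart_index M) (E : set 'rV[R]_n).
Hypothesis oE : open E.
Hypothesis Ea : E `<=` chart_range a.
Local Notation F := (f \o chartV a).
Hypothesis sF : smooth_on E F.
Variable phi : smooth_form M p.
Implicit Types (y v w u : 'rV[R]_n) (e : 'M[R]_(p, n)).

Definition hess_trace y e : R := \sum_i hess g f a y (row i e) (row i e).
Definition grad_square y e : R := \sum_i 'D_(row i e) F y ^+ 2.

Lemma form_multilinear y : chart_range a y -> multilinear (phi a y).
Proof. by move=> ay v i c u w; exact: form_linear. Qed.

Lemma form_alternate y : chart_range a y -> row_alternating (phi a y).
Proof. by move=> ay v i j; exact: form_alternating. Qed.

Lemma hess_lin_l y c v w u : E y ->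
  hess g f a y (c *: v + w) u = c * hess g f a y v u + hess g f a y w u.
Proof. by move=> Ey; rewrite /hess (levi_civita_linear g oE Ea sF Ey) ipDl. Qed.

Lemma hess_lin_r y c v w u : E y ->
  hess g f a y u (c *: v + w) = c * hess g f a y u v + hess g f a y u w.
Proof. by move=> Ey; rewrite /hess (ipDr (Defs.metric_sym g (Ea Ey))). Qed.

Section Limits.
Context {T : Type} (Phi : set_system T) {FPhi : Filter Phi}.
Variables (Y : T -> 'rV[R]_n) (y0 : 'rV[R]_n).
Hypothesis Ey0 : E y0.
Hypothesis Yy0 : Y t @[t --> Phi] --> y0.

Let nearE : \forall t \near Phi, E (Y t).
Proof. exact: Yy0 (open_near oE Ey0). Qed.

Let cvgY (H : 'rV[R]_n -> R) (D : set 'rV[R]_n) : smooth_on D H -> D y0 ->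
  H (Y t) @[t --> Phi] --> H y0.
Proof.
by move=> sH Dy; apply: (cvg_comp _ _ Yy0); exact: smooth_continuous sH Dy.
Qed.

Lemma cvg_grad : gradient g f a (Y t) @[t --> Phi] --> gradient g f a y0.
Proof.
by apply: cvg_mxP => i j; rewrite ord1; apply: (cvgY (smooth_gradient g oE Ea sF j)).
Qed.

Lemma cvg_dF (v : T -> 'rV[R]_n) v0 : v t @[t --> Phi] --> v0 ->
  'D_(v t) F (Y t) @[t --> Phi] --> 'D_v0 F y0.
Proof.
apply: (linear_cvg (L := fun t v => 'D_v F (Y t)) (L0 := fun v => 'D_v F y0)).
- by apply: filterS nearE => t Et; exact: (derive_linear oE sF Et).
- exact: (derive_linear oE sF Ey0).
- by move=> u; apply: (cvgY (smooth_derive u oE sF)).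
Qed.

Lemma cvg_ip (v w : T -> 'rV[R]_n) v0 w0 : v t @[t --> Phi] --> v0 ->
  w t @[t --> Phi] --> w0 ->
  ip (gm a (Y t)) (v t) (w t) @[t --> Phi] --> ip (gm a y0) v0 w0.
Proof.
move=> vv0 ww0.
apply: (linear_cvg (L := fun t v => ip (gm a (Y t)) v (w t)) (L0 := fun v => ip
  (gm a y0) v w0)) vv0.
- by apply: filterS nearE => t Et c x z; exact: ipDl.
- by move=> c x z; exact: ipDl.
move=> u; apply: (linear_cvg (L := fun t v => ip (gm a (Y t)) u v) (L0 := fun v => ip
  (gm a y0) u v)) ww0.
- apply: filterS nearE => t Et c x z; exact: (ipDr (Defs.metric_sym g (Ea Et))).
- move=> c x z; exact: (ipDr (Defs.metric_sym g (Ea Ey0))).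
- by move=> x; apply: (cvgY (smooth_ip g a u x)); exact: Ea.
Qed.

Lemma cvg_hess (v u : T -> 'rV[R]_n) v0 u0 : v t @[t --> Phi] --> v0 ->
  u t @[t --> Phi] --> u0 ->
  hess g f a (Y t) (v t) (u t) @[t --> Phi] --> hess g f a y0 v0 u0.
Proof.
move=> vv0 uu0.
apply: (linear_cvg (L := fun t v => hess g f a (Y t) v (u t))
  (L0 := fun v => hess g f a y0 v u0)) vv0.
- by apply: filterS nearE => t Et c x z; exact: hess_lin_l.
- by move=> c x z; exact: hess_lin_l.
move=> {v v0}v; apply: (linear_cvg (L := fun t u => hess g f a (Y t) v u)
  (L0 := fun u => hess g f a y0 v u)) uu0.
- by apply: filterS nearE => t Et c x z; exact: hess_lin_r.
- by move=> c x z; exact: hess_lin_r.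
move=> {u u0}u; rewrite (hessE g oE Ea sF v u Ey0).
have near_range : \forall t \near Phi, chart_range a (Y t).
  by apply: filterS nearE => t; exact: Ea.
have ay0 := Ea Ey0.
have dm t' x z : dmetric g a (Y t) t' x z @[t --> Phi] --> dmetric g a y0 t' x z.
  by apply: (cvgY (smooth_derive t' (@chart_range_open _ _ _ M a) (smooth_ip g a x z))).
have H : 'D_v ('D_u F) (Y t) - 2^-1 * (dmetric g a (Y t) v (gradient g f a (Y t)) u
    + dmetric g a (Y t) u v (gradient g f a (Y t))
    - dmetric g a (Y t) (gradient g f a (Y t)) v u) @[t --> Phi] -->
  'D_v ('D_u F) y0 - 2^-1 * (dmetric g a y0 v (gradient g f a y0) u
    + dmetric g a y0 u v (gradient g f a y0)
    - dmetric g a y0 (gradient g f a y0) v u).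
  apply: cvgB.
    exact: (cvgY (smooth_derive v oE (smooth_derive u oE sF))).
  apply: cvgM; first exact: cvg_cst.
  apply: cvgB; first apply: cvgD.
  - apply: (linear_cvg (L := fun t G => dmetric g a (Y t) v G u)
    (L0 := fun G => dmetric g a y0 v G u)) cvg_grad => //.
      by apply: filterS near_range => t at' c x z; exact: dmetricDl.
    by move=> c x z; exact: dmetricDl.
  - apply: (linear_cvg (L := fun t G => dmetric g a (Y t) u v G)
    (L0 := fun G => dmetric g a y0 u v G)) cvg_grad => //.
      by apply: filterS near_range => t at' c x z; exact: dmetricDr.
    by move=> c x z; exact: dmetricDr.
  - apply: (linear_cvg (L := fun t G => dmetric g a (Y t) G v u)
    (L0 := fun G => dmetric g a y0 G v u)) cvg_grad => //.
      by apply: filterS near_range => t at' c x z; exact: dmetricDt.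
    by move=> c x z; exact: dmetricDt.
apply: cvg_trans H; apply: near_eq_cvg; apply: filterS nearE => t Et.
by rewrite [RHS](hessE g oE Ea sF v u Et).
Qed.

Variables (e : T -> 'M[R]_(p, n)) (e0 : 'M[R]_(p, n)).
Hypothesis ee0 : e t @[t --> Phi] --> e0.

Lemma cvg_row i : row i (e t) @[t --> Phi] --> row i e0.
Proof.
apply: cvg_mxP => k j; rewrite mxE; under eq_fun do rewrite mxE.
exact: cvg_coord ee0.
Qed.

Lemma cvg_form : phi a (Y t) (e t) @[t --> Phi] --> phi a y0 e0.
Proof.
apply: (multilinear_cvg (F := fun t => phi a (Y t)) (F0 := phi a y0)) ee0.
- by apply: filterS nearE => t Et; apply/form_multilinear/Ea.
- exact/form_multilinear/Ea.
- by move=> u; apply: (cvgY (form_smooth phi a u)); exact: Ea.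
Qed.

Lemma cvg_hess_trace : hess_trace (Y t) (e t) @[t --> Phi] --> hess_trace y0 e0.
Proof. by apply: cvg_sumR => i _; apply: cvg_hess; exact: cvg_row. Qed.

Lemma cvg_grad_square : grad_square (Y t) (e t) @[t --> Phi] --> grad_square y0 e0.
Proof.
apply: cvg_sumR => i _; rewrite expr2; under eq_fun do rewrite expr2.
by apply: cvgM; apply: cvg_dF; exact: cvg_row.
Qed.

End Limits.
End LocalEstimate.

Section Estimate.
Context {R : realType} {n p : nat} {X : topologicalType} {M : manifold R n X}.
Variable g : riemannian_metric M.
Local Notation gm a := (metric_mx g a).
Variable phi : smooth_form M p.
Hypothesis cal : calibration g phi.
Variables (f : X -> R) (a : chart_index M) (E : set 'rV[R]_n).
Hypothesis oE : open E.
Hypothesis Ea : E `<=` chart_range a.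
Local Notation F := (f \o chartV a).
Hypothesis sF : smooth_on E F.
Implicit Types (y v w u : 'rV[R]_n) (e : 'M[R]_(p, n)).

Lemma comass_le1 y : chart_range a y ->
  forall v : 'M[R]_(p, n), \det (v *m gm a y *m v^T) = 1 -> phi a y v <= 1.
Proof.
move=> ay v dv; have [ax xy] := chart_rangeP ay.
by have := cal.2 a (chartV a y) v ax; rewrite xy; apply.
Qed.

Definition phi_frame y e := e *m gm a y *m e^T = 1%:M /\ phi a y e = 1.

Lemma phi_frame_plane y e : phi_frame y e -> phi_plane g phi a y e.
Proof. by move=> [oe pe]; split => //; rewrite /unit_simple oe det1. Qed.

Lemma phi_hessian_frame y e : E y -> phi_frame y e ->
  phi_hessian g phi f a y e = hess_trace g f a y e.
Proof.
move=> Ey [oe pe]; have ay := Ea Ey; apply: eq_bigr => i _.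
by rewrite (comass_form_coord (Defs.metric_sym g ay) (metric_definite g ay)
  (form_multilinear phi ay) (form_alternate phi ay) (comass_le1 ay) _ _ oe pe).
Qed.

(** Both quantities are derivation forms, with L = nabla (grad f) and with
    L w = (w f) grad f, so a single orthonormal frame computes them as traces. *)
Lemma phi_plane_frame y (v : 'M[R]_(p, n)) : E y -> phi_plane g phi a y v ->
  exists2 e, phi_frame y e &
    phi_hessian g phi f a y v = hess_trace g f a y e /\
    derivation_form (phi a y) (fun w => 'D_w F y *: gradient g f a y) v =
      grad_square f a y e.
Proof.
move=> Ey [dv pv]; have ay := Ea Ey.
have [e [oe pe] eL] := comass_trace (Defs.metric_sym g ay) (metric_definite g ay)
  (form_multilinear phi ay) (form_alternate phi ay) (comass_le1 ay) dv pv.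
exists e => //; split.
  apply: (eL (fun w => levi_civita g a y w (gradient g f a))) => c u w.
  exact: (levi_civita_linear g oE Ea sF Ey).
rewrite eL => [|c u w].
  apply: eq_bigr => i _; rewrite ipZl (gradientE g oE Ea sF _ Ey).
  by rewrite expr2.
by rewrite (derive_linear oE sF Ey) scalerDl scalerA.
Qed.

(** The j-th coordinate is the inner product with the j-th row of the inverse
    metric, whose squared length is the j-th diagonal coefficient.  This confines
    the orthonormal frames at points near y0 to a fixed box. *)
Lemma frame_bound y e i j : chart_range a y -> e *m gm a y *m e^T = 1%:M ->
  `|e i j| ^+ 2 <= invmx (gm a y) j j.
Proof.
move=> ay oe; pose w : 'rV[R]_n := delta_mx 0 j *m invmx (gm a y).
have wv v : ip (gm a y) w v = v 0 j.
  by rewrite /ip /w mulmxKV ?metric_unit// -rowE !mxE.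
have sG := Defs.metric_sym g ay.
have ee : ip (gm a y) (row i e) (row i e) = 1 by rewrite -gramE oe mxE eqxx.
have := ip_cauchy w sG (metric_definite g ay) ee.
rewrite !wv mxE real_normK ?num_real// => /le_trans; apply.
by rewrite /w -rowE mxE.
Qed.

Lemma grad_square_ge0 y e : 0 <= grad_square f a y e.
Proof. by apply: sumr_ge0 => i _; exact: sqr_ge0. Qed.

(** The open condition is checked near each pair (y0, e0), and the compactness
    of the box containing all orthonormal frames makes it uniform in the frame. *)
Lemma boundary_estimate y0 : E y0 -> F y0 = 0 ->
  (forall e, phi_frame y0 e -> (forall i, 'D_(row i e) F y0 = 0) ->
     0 < hess_trace g f a y0 e) ->
  \forall y \near y0, E y -> F y < 0 -> forall e, phi_frame y e ->
    0 < - F y * hess_trace g f a y e + grad_square f a y e.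
Proof.
move=> Ey0 Fy0 pos; have ay0 := Ea Ey0.
(* C bounds the diagonal of the inverse metric near y0; as C >= 1, it bounds the
   coordinates of orthonormal frames as well as their squares. *)
pose C : R := \sum_j `|invmx (gm a y0) j j| + 1.
have C1 : 1 <= C by rewrite /C lerDr sumr_ge0.
pose P y e := E y -> F y < 0 -> phi_frame y e ->
  0 < - F y * hess_trace g f a y e + grad_square f a y e.
have bnd : \forall y \near y0, chart_range a y -> forall e i j,
    e *m gm a y *m e^T = 1%:M -> `|e i j| <= C.
  have H j : \forall y \near y0, invmx (gm a y) j j <= C.
    have cj := smooth_continuous (smooth_invmx g a j j) ay0.
    have /cvgrPdist_le/(_ _ ltr01) := cj; apply: filterS => y.
    rewrite distrC => /(le_trans (ler_norm _)); rewrite lerBlDr => /le_trans; apply.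
    rewrite addrC lerD2r (bigD1 j)//= (le_trans (ler_norm _))// lerDl.
    exact: sumr_ge0.
  have : \forall y \near y0, forall j, invmx (gm a y) j j <= C.
    exact: filter_forall H.
  apply: filterS => y HC ay e i j oe.
  have C0 : 0 <= C := le_trans ler01 C1.
  rewrite -(@ler_pXn2r _ 2)// ?nnegrE//.
  apply: (le_trans (frame_bound i j ay oe)); apply: (le_trans (HC j)).
  by rewrite expr2 ler_peMr.
have nc : \forall y \near y0, [set e : 'M[R]_(p, n) | forall i j, `|e i j| <= C] `<=` P y.
  apply: ((compact_near_coveringP _).1 (@box_compact R p n C) _ (nbhs y0) P).
  move=> e0 _; pose Phi := filter_prod (nbhs e0) (nbhs y0).
  have PF : Filter Phi by exact: filter_prod_filter.
  have Yc : (fun t : 'M[R]_(p, n) * 'rV[R]_n => t.2) t @[t --> Phi] --> y0 by exact: cvg_snd.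
  have ec : (fun t : 'M[R]_(p, n) * 'rV[R]_n => t.1) t @[t --> Phi] --> e0 by exact: cvg_fst.
  (* If e0 is not an orthonormal frame of a phi-plane at y0, neither are its neighbours. *)
  have [fr|nfr] := pselect (phi_frame y0 e0); last first.
    have [[i [j gij]]|pe] : (exists i j, ip (gm a y0) (row i e0) (row j e0) != (i == j)%:R)
        \/ phi a y0 e0 != 1.
      apply: contrapT => /not_orP[H1 /negP]; rewrite negbK => /eqP H2.
      apply: nfr; split => //; apply/matrixP => i j; rewrite gramE mxE.
      by apply/eqP; apply: contrapT => /negP H; apply: H1; exists i, j.
    - have gcv : ip (gm a t.2) (row i t.1) (row j t.1) @[t --> Phi] -->
          ip (gm a y0) (row i e0) (row j e0).
        by apply: (cvg_ip oE Ea Ey0 Yc); exact: cvg_row.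
      apply: (@filterS _ Phi PF _ _ _ (cvg_near_neq gcv gij)) => -[e y] /= H _ _ [oe _].
      by move: H; rewrite -gramE oe mxE eqxx.
    - have pcv : phi a t.2 t.1 @[t --> Phi] --> phi a y0 e0.
        exact: (cvg_form oE Ea Ey0 Yc ec).
      apply: (@filterS _ Phi PF _ _ _ (cvg_near_neq pcv pe)) => -[e y] /= H _ _ [_ pe'];
        by move: H; rewrite pe' eqxx.
  have cS : hess_trace g f a t.2 t.1 @[t --> Phi] --> hess_trace g f a y0 e0.
    exact: (cvg_hess_trace oE Ea sF Ey0 Yc ec).
  have cQ : grad_square f a t.2 t.1 @[t --> Phi] --> grad_square f a y0 e0.
    exact: (cvg_grad_square oE sF Ey0 Yc ec).
  have cF : F t.2 @[t --> Phi] --> F y0.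
    by apply: (cvg_comp _ _ Yc); exact: smooth_continuous sF Ey0.
  (* Tangent planes use the positivity of the Hessian, the others that of the square. *)
  have [Q0|Q0] := eqVneq (grad_square f a y0 e0) 0.
    have t0 i : 'D_(row i e0) F y0 = 0.
      apply/eqP; rewrite -sqrf_eq0; apply/eqP; move: i isT; apply/psumr_eq0P => //.
      by move=> i _; exact: sqr_ge0.
    apply: (@filterS _ Phi PF _ _ _ (cvg_near_gt0 cS (pos _ fr t0))) => -[e y] /= S0 Ey Fy _.
    by rewrite ltr_pwDl ?grad_square_ge0// mulr_gt0// oppr_gt0.
  have cT : - F t.2 * hess_trace g f a t.2 t.1 + grad_square f a t.2 t.1 @[t --> Phi] -->
      - F y0 * hess_trace g f a y0 e0 + grad_square f a y0 e0.
    by apply: cvgD => //; apply: cvgM => //; exact: cvgN.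
  have T0 : 0 < - F y0 * hess_trace g f a y0 e0 + grad_square f a y0 e0.
    by rewrite Fy0 oppr0 mul0r add0r lt_neqAle eq_sym Q0 grad_square_ge0.
  by apply: (@filterS _ Phi PF _ _ _ (cvg_near_gt0 cT T0)) => -[e y] /= H _ _ _.
apply: filterS2 bnd nc => y Hb HP Ey Fy e fr.
by apply: HP => // i j; apply: Hb; [exact: Ea|case: fr].
Qed.

End Estimate.

(** * Boundary convexity *)

Section SmoothFun.
Context {R : realType} {n : nat} {X : topologicalType} {M : manifold R n X}.
Implicit Types (W : set X) (f : X -> R).

Lemma smooth_fun_sub W W' f : W' `<=` W -> smooth_fun M W f -> smooth_fun M W' f.
Proof.
move=> WW sf a; apply: smooth_on_sub (sf a); apply: image_subset => x [ax /WW Wx].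
by split.
Qed.

Lemma smooth_fun_comp W f (E : set R) (S : set (R -> R)) h : open W ->
  smooth_fun M W f -> (forall x, W x -> E (f x)) -> derivation_closed E S -> S h ->
  smooth_fun M W (h \o f).
Proof.
move=> oW sf fE cS Sh a.
apply: (smooth_comp (chart_image_open oW) (sf a) _ cS Sh) => _ [x [ax Wx] <-].
by rewrite /= chartK//; exact: fE.
Qed.

Lemma smooth_fun_continuous W f x : open W -> smooth_fun M W f -> W x ->
  {for x, continuous f}.
Proof.
move=> oW sf Wx; have [a ax] := dom_cover M x.
have cF : {for chart a x, continuous (f \o chartV a)}.
  by apply: smooth_continuous (sf a) _; exists x.
have := continuous_comp (chart_continuous ax) cF.
apply: continuous_ext; apply: filterS (open_nbhs_nbhs (conj (dom_open a) ax)) => z az.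
by rewrite /= chartK.
Qed.

End SmoothFun.


Section Boundary.
Context {R : realType} {n p : nat} {X : topologicalType} {M : manifold R n X}.
Variables (g : riemannian_metric M) (phi : smooth_form M p).
Hypothesis cal : calibration g phi.
Variable Om : set X.
Hypothesis oOm : open Om.
Local Notation gm a := (metric_mx g a).

Lemma defining_function_boundary U rho x : defining_function g Om U rho ->
  boundary Om x -> U x /\ rho x = 0.
Proof.
move=> [oU clU sr OmE _] [clx]; rewrite ((interior_id Om).1 oOm) => nOx.
have Ux := clU _ clx; split=> //; apply/eqP; rewrite eq_le; apply/andP; split; last first.
  by rewrite leNgt; apply/negP => rx; apply: nOx; rewrite OmE; split.
rewrite leNgt; apply/negP => rx.
have cr := smooth_fun_continuous oU sr Ux.
have [z [Oz /= rz]] := clx _ (cr _ (open_nbhs_nbhs (conj (@open_gt R 0) rx))).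
by move: Oz; rewrite OmE => -[_ /=]; rewrite ltNge ltW.
Qed.

Lemma gradient_neq0_derive (f : X -> R) a (y : 'rV[R]_n) :
  gradient g f a y != 0 -> exists w, 'D_w (f \o chartV a) y != 0.
Proof.
move=> g0; apply: contrapT => H; move/eqP: g0; apply.
rewrite /gradient (_ : (\row__ _) = 0) ?mul0mx//; apply/rowP => i; rewrite !mxE.
by apply/eqP; apply: contrapT => /negP Hi; apply: H; exists (basis_vector i).
Qed.

(** Strict convexity does not depend on the defining function: on tangent
    vectors the second derivatives compare by [boundary_second_order], while the
    metric terms of the Hessian are linear in the gradient, which is multiplied by
    lam. *)
Lemma tangential_hess_trace_gt0 U rho a x (e : 'M[R]_(p, n)) :
  strictly_convex_boundary g phi Om -> defining_function g Om U rho ->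
  boundary Om x -> dom a x -> phi_frame g phi a (chart a x) e ->
  (forall i, 'D_(row i e) (rho \o chartV a) (chart a x) = 0) ->
  0 < hess_trace g rho a (chart a x) e.
Proof.
move=> [U0 [rho0 [def0 conv0]]] def bx ax fr tan.
have [U0x r0x] := defining_function_boundary def0 bx.
have [Ux rx] := defining_function_boundary def bx.
have [oU0 clU0 sr0 OmE0 gr0] := def0; have [oU clU sr OmE gr] := def.
pose E := chart a @` (dom a `&` (U `&` U0)).
have oE : open E by apply: chart_image_open; exact: openI.
have Ea : E `<=` chart_range a by exact: chart_image_sub.
have Ex : E (chart a x) by exists x.
have sF : smooth_on E (rho \o chartV a).
  by apply: (smooth_fun_sub _ sr a) => z [].
have sF0 : smooth_on E (rho0 \o chartV a).
  by apply: (smooth_fun_sub _ sr0 a) => z [].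
have ry : (rho \o chartV a) (chart a x) = 0 by rewrite /= chartK.
have r0y : (rho0 \o chartV a) (chart a x) = 0 by rewrite /= chartK.
have rs z : E z -> (rho \o chartV a) z < 0 -> (rho0 \o chartV a) z < 0.
  move=> [x' [ax' [Ux' U0x']] <-]; rewrite /= !chartK// => rx'.
  have : Om x' by rewrite OmE; split.
  by rewrite OmE0 => -[].
have ex : exists w, 'D_w (rho \o chartV a) (chart a x) != 0.
  exact/gradient_neq0_derive/gr.
have ex0 : exists w, 'D_w (rho0 \o chartV a) (chart a x) != 0.
  exact/gradient_neq0_derive/gr0.
have [lam l0 lamE] := boundary_covector oE sF sF0 Ex ry r0y rs ex ex0.
have tan0 i : 'D_(row i e) (rho0 \o chartV a) (chart a x) = 0.
  by rewrite lamE tan mulr0.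
have G0 : gradient g rho0 a (chart a x) = lam *: gradient g rho a (chart a x).
  apply: (@ip_inj _ _ _ _ g a (chart a x)); first exact: Ea.
  by move=> u; rewrite ipZl (gradientE g oE Ea sF0 _ Ex) (gradientE g oE Ea sF _ Ex).
have := conv0 a x e bx ax (phi_frame_plane fr) tan0.
rewrite (phi_hessian_frame cal rho0 Ea Ex fr) => /lt_le_trans H.
rewrite -(pmulr_rgt0 _ l0); apply: H; rewrite mulr_sumr; apply: ler_sum => i _.
have S := boundary_second_order oE sF sF0 Ex ry r0y rs l0 ex lamE (tan i).
have ay := Ea _ Ex.
rewrite (hessE g oE Ea sF0 _ _ Ex) (hessE g oE Ea sF _ _ Ex) G0.
move: S; move: (gradient g rho a (chart a x)) (row i e) => G v.
rewrite dmetricZl// dmetricZr// dmetricZt//.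
move: ('D_v ('D_v (rho \o chartV a)) (chart a x)) ('D_v ('D_v (rho0 \o chartV a)) (chart a x)).
move: (dmetric g a (chart a x) v G v) (dmetric g a (chart a x) v v G)
  (dmetric g a (chart a x) G v v) => d1 d2 d3 A B AB.
have -> : lam * (A - 2^-1 * (d1 + d2 - d3)) = lam * A - 2^-1 *
  (lam * d1 + lam * d2 - lam * d3).
  by ring.
by rewrite lerD2r.
Qed.

(** The hypothesis is rho^2 times the phi-Hessian of - log (- rho). *)
Lemma neglog_strictly_psh U rho a x : defining_function g Om U rho -> Om x -> dom a x ->
  (forall e, phi_frame g phi a (chart a x) e ->
    0 < - rho x * hess_trace g rho a (chart a x) e +
        grad_square rho a (chart a x) e) ->
  strictly_psh_at g phi (neglog \o rho) x.
Proof.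
move=> [oU clU sr OmE _] Ox ax H.
have OmU : Om `<=` U by rewrite OmE => z [].
have sO := smooth_fun_sub OmU sr.
have r0 z : Om z -> rho z < 0 by rewrite OmE => -[].
have sl : smooth_fun M Om (neglog \o rho).
  by apply: (smooth_fun_comp oOm sO r0 derivation_closed_neglog); left.
apply: (strictly_psh_chart oOm sl Ox ax) => v pv.
pose E := chart a @` (dom a `&` Om).
have oE : open E by exact: chart_image_open.
have Ea : E `<=` chart_range a by exact: chart_image_sub.
have Ex : E (chart a x) by exists x.
have E0 z : E z -> (rho \o chartV a) z < 0.
  by move=> [x' [ax' Ox'] <-]; rewrite /= chartK//; exact: r0.
rewrite (phi_hessian_post (h1 := fun t => - t^-1) (h2 := fun t => t^-1 ^+ 2) g oE Ea (sO a)
  (fun z Ez => is_derive_neglog (E0 z Ez))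
  (fun z Ez => is_derive_neglog2 (E0 z Ez)) (sl a) phi v Ex).
have [e fr [-> ->]] := phi_plane_frame cal oE Ea (sO a) Ex pv.
rewrite /= chartK//; have := H e fr; have := r0 x Ox.
move: (hess_trace _ _ _ _ _) (grad_square _ _ _ _) (rho x) => S Q r rr.
have -> : - r^-1 * S + r^-1 ^+ 2 * Q = r^-1 ^+ 2 * (- r * S + Q).
  by field; rewrite lt_eqF.
by rewrite pmulr_rgt0// exprn_even_gt0//= invr_eq0 lt_eqF.
Qed.

Lemma neglog_strictly_psh_near U rho x :
  strictly_convex_boundary g phi Om -> defining_function g Om U rho ->
  boundary Om x -> \forall z \near x, Om z -> strictly_psh_at g phi (neglog \o rho) z.
Proof.
move=> conv def bx; have [a ax] := dom_cover M x.
have [Ux rx] := defining_function_boundary def bx.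
have [oU clU sr OmE gr] := def.
pose E := chart a @` (dom a `&` U).
have oE : open E by exact: chart_image_open.
have Ea : E `<=` chart_range a by exact: chart_image_sub.
have Ex : E (chart a x) by exists x.
have ry : (rho \o chartV a) (chart a x) = 0 by rewrite /= chartK.
have pos e : phi_frame g phi a (chart a x) e ->
    (forall i, 'D_(row i e) (rho \o chartV a) (chart a x) = 0) ->
    0 < hess_trace g rho a (chart a x) e.
  exact: tangential_hess_trace_gt0 conv def bx ax.
have nb := boundary_estimate oE Ea (sr a) Ex ry pos.
have dn := open_nbhs_nbhs (conj (dom_open a) ax).
have cn := chart_continuous ax nb.
apply: filterS2 dn cn => z az Hz Oz.
have [Uz rz] : U z /\ rho z < 0 by move: Oz; rewrite OmE => -[].
apply: (neglog_strictly_psh def Oz az) => e fr.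
have := Hz; rewrite /= chartK// => Hz'; apply: Hz' => //.
by exists z.
Qed.

Lemma neglog_strictly_psh_outside_compact U rho : compact (closure Om) ->
  strictly_convex_boundary g phi Om -> defining_function g Om U rho ->
  strictly_psh_outside_compact g phi Om (neglog \o rho).
Proof.
move=> cO conv def; have [oU clU sr OmE gr] := def.
(* The exceptional set consists of the points of the closure that are not interior to
   the good set B; it contains no boundary point. *)
pose B := [set x | Om x -> strictly_psh_at g phi (neglog \o rho) x].
exists (closure Om `\` B°); split.
- apply: subclosed_compact cO _; last by move=> x [].
  rewrite setDE; apply: closedI; first exact: closed_closure.
  exact/open_closedC/open_interior.
- move=> x [clx nBx]; apply: contrapT => nOx; apply: nBx.
  apply: (neglog_strictly_psh_near conv def); split => //.
  by rewrite ((interior_id Om).1 oOm).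
- split.
    apply: (@smooth_fun_sub _ _ _ _ Om); first by move=> x [].
    have OmU : Om `<=` U by rewrite OmE => z [].
    apply: (smooth_fun_comp oOm (smooth_fun_sub OmU sr) _ derivation_closed_neglog);
      last by left.
    by rewrite OmE => x [].
  move=> x [Ox nK]; have Bx : B° x.
    by apply: contrapT => nB; apply: nK; split => //; exact: subset_closure.
  exact: (interior_subset Bx) Ox.
Qed.

End Boundary.

(** * The exhaustion function *)

Section Exhaustion.
Context {R : realType} {n p : nat} {X : topologicalType} {M : manifold R n X}.
Variables (g : riemannian_metric M) (phi : smooth_form M p).
Hypothesis cal : calibration g phi.
Variable Om : set X.
Hypothesis oOm : open Om.

Lemma compact_upper_bound (K : set X) (u : X -> R) : compact K ->
  (forall x, K x -> {for x, continuous u}) -> exists c, forall x, K x -> u x <= c.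
Proof.
move=> cK cu; have [[x0 Kx0]|K0] := pselect (K !=set0); last first.
  by exists 0 => x Kx; case: K0; exists x.
have [|c _ cP] := @compact_EVT_max X R u K (ex_intro _ x0 Kx0) cK.
  by apply: continuous_in_subspaceT => x /set_mem; exact: cu.
by exists (u c) => x Kx; apply: cP; rewrite inE.
Qed.

(** Where u <= c the first two derivatives of the cutoff vanish.  Where u > c
    the first one is positive; the term of the second one is a nonnegative multiple
    of a sum of squares. *)
Lemma cutoff_post_psh (u : X -> R) (c : R) a x (v : 'M[R]_(p, n)) :
  smooth_fun M Om u -> Om x -> dom a x ->
  phi_plane g phi a (chart a x) v ->
  (c < u x -> 0 < phi_hessian g phi u a (chart a x) v) ->
  let H := phi_hessian g phi ((fun t => cutoff (t - c)) \o u) a (chart a x) v in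
  0 <= H /\ (c < u x -> 0 < H).
Proof.
move=> su Ox ax pv Hu.
have sf : smooth_fun M Om ((fun t => cutoff (t - c)) \o u).
  have hS : flat_class c (fun t => cutoff (t - c)) by left.
  exact: (smooth_fun_comp oOm su (fun _ _ => I) (@derivation_closed_flat R c) hS).
have oE := chart_image_open (a := a) oOm.
have Ea := @chart_image_sub _ _ _ _ a Om.
have Ex : (chart a @` (dom a `&` Om)) (chart a x) by exists x.
rewrite /= (phi_hessian_post (h1 := fun t => flat (1 + 'X) (t - c))
  (h2 := fun t => flat 'X^3 (t - c)) g oE Ea (su a)
  (fun z _ => is_derive_shiftN (is_derive_cutoff _))
  (fun z _ => is_derive_shiftN (is_derive_cutoff2 _)) (sf a) phi v Ex).
have [e _ [_ ->]] := phi_plane_frame cal oE Ea (su a) Ex pv.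
rewrite /= chartK//.
have Q0 := grad_square_ge0 u a (chart a x) e.
have F0 : 0 <= flat 'X^3 (u x - c) * grad_square u a (chart a x) e.
  by rewrite mulr_ge0// cutoff_derive2_ge0.
have P0 : c < u x -> 0 < flat (1 + 'X) (u x - c) * phi_hessian g phi u a (chart a x) v.
  by move=> cu; rewrite mulr_gt0 ?Hu// cutoff_derive_gt0// subr_gt0.
split; last by move=> cu; rewrite ltr_pwDl// P0.
have [cu|uc] := ltP c (u x); first by rewrite addr_ge0// ltW// P0.
by rewrite flat_le0 ?subr_le0// mul0r add0r.
Qed.

(** The bound on rho keeps limit points of the sublevel set off the boundary, so
    the set is closed in the compact closure of Omega. *)
Lemma sublevel_compact U rho (f : X -> R) (c eps : R) : compact (closure Om) ->
  defining_function g Om U rho -> smooth_fun M Om f -> 0 < eps ->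
  (forall x, Om x -> f x <= c -> rho x <= - eps) ->
  compact (Om `&` [set x | f x <= c]).
Proof.
move=> cO [oU clU sr OmE _] sf e0 H.
apply: subclosed_compact cO _; last by move=> x [Ox _]; exact: subset_closure.
move=> x clx.
have clOx : closure Om x by apply: closure_subset clx => z [].
have Ux := clU _ clOx.
have cr := smooth_fun_continuous oU sr Ux.
have rx : rho x <= - eps.
  rewrite leNgt; apply/negP => rx.
  have [z [[Oz fz] /= rz]] := clx _ (cr _ (open_nbhs_nbhs (conj (@open_gt R (- eps)) rx))).
  by have := H z Oz fz; rewrite leNgt rz.
have Ox : Om x.
  by rewrite OmE; split => //=; rewrite (le_lt_trans rx)// oppr_lt0.
split => //=; rewrite leNgt; apply/negP => fx.
have cf := smooth_fun_continuous oOm sf Ox.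
have [z [[_ /= fz] /= cz]] := clx _ (cf _ (open_nbhs_nbhs (conj (@open_gt R c) fx))).
by move: fz; rewrite leNgt cz.
Qed.

Lemma strictly_convex_at_infinity_of_neglog U rho : compact (closure Om) ->
  defining_function g Om U rho ->
  strictly_psh_outside_compact g phi Om (neglog \o rho) ->
  strictly_convex_at_infinity g phi Om.
Proof.
move=> cO def [K [cK KO [_ sK]]]; have [oU clU sr OmE _] := def.
have OmU : Om `<=` U by rewrite OmE => z [].
have r0 z : Om z -> rho z < 0 by rewrite OmE => -[].
have su : smooth_fun M Om (neglog \o rho).
  apply: (smooth_fun_comp oOm (smooth_fun_sub OmU sr) r0 derivation_closed_neglog).
  by left.
(* Above the level c the function - log (- rho) is strictly plurisubharmonic. *)
have [c cP] : exists c, forall x, K x -> (neglog \o rho) x <= c.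
  by apply: compact_upper_bound => // x /KO Ox; exact: smooth_fun_continuous su Ox.
pose f := (fun t => cutoff (t - c)) \o (neglog \o rho).
have sf : smooth_fun M Om f.
  have hS : flat_class c (fun t => cutoff (t - c)) by left.
  exact: (smooth_fun_comp oOm su (fun _ _ => I) (@derivation_closed_flat R c) hS).
have H a x (v : 'M[R]_(p, n)) : Om x -> dom a x -> phi_plane g phi a (chart a x) v ->
    0 <= phi_hessian g phi f a (chart a x) v /\
    (c < (neglog \o rho) x -> 0 < phi_hessian g phi f a (chart a x) v).
  move=> Ox ax pv; apply: (cutoff_post_psh su Ox ax pv) => cx.
  apply: sK => //; split => // Kx; have := cP x Kx.
  by rewrite leNgt cx.
have cS d : compact (Om `&` [set x | f x <= d]).
  apply: (@sublevel_compact U rho f d (expR (- (1 + `|d| * expR 1 + c)))) => //.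
    exact: expR_gt0.
  move=> x Ox /cutoff_bounded; rewrite lerBlDr /= /neglog.
  have r0x : 0 < - rho x by rewrite oppr_gt0 r0.
  rewrite lerNl => B; rewrite lerNr -[leRHS]lnK ?posrE// ler_expR.
  exact: B.
exists f; split => //.
  by split => // a x v Ox ax pv; have [] := H a x v Ox ax pv.
exists (Om `&` [set x | f x <= 0]); split; first exact: cS.
  by move=> x [].
split; first by apply: smooth_fun_sub sf => x [].
move=> x [Ox nf] a v ax pv; apply: (H a x v Ox ax pv).2.
rewrite ltNge; apply/negP => uc; apply: nf; split => //=.
by rewrite /f /= cutoff_le0// subr_le0.
Qed.

End Exhaustion.

Theorem theorem4p5 (R : realType) (n p : nat) (X : topologicalType)
    (M : manifold R n X) (g : riemannian_metric M) (phi : smooth_form M p)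
    (Omega U : set X) (rho : X -> R) :
  (0 < p)%N -> calibration g phi -> ~ compact [set: X] ->
  Omega !=set0 -> open Omega -> connected Omega -> compact (closure Omega) ->
  strictly_convex_boundary g phi Omega ->
  defining_function g Omega U rho ->
  let delta x := - rho x in
  strictly_psh_outside_compact g phi Omega (fun x => - ln (delta x)) /\
  strictly_convex_at_infinity g phi Omega.
Proof.
move=> _ cal _ _ oOm _ cO conv def delta.
have spsh := neglog_strictly_psh_outside_compact cal oOm cO conv def.
by split => //; exact: (strictly_convex_at_infinity_of_neglog cal oOm cO def spsh).
Qed.
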